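(* Let $\lambda>\kappa$ be regular infinite cardinals, let $P$ be a partial order with order relation $\le_P$, and let $\theta$ be a sufficiently large regular cardinal. The following are equivalent. (1) $P\cap M\le_\kappa P$ for all $M\prec(H(\theta),\in,\le_P)$ that satisfy $M\cap\lambda\in\lambda+1$. (2) $P\cap M\le_\kappa P$ for all $M\prec(H(\theta),\in,\le_P)$ that satisfy $|M|\cap\lambda\subseteq M\cap\lambda\in\lambda+1$. (3) $P\cap M\le_\kappa P$ for all $M\prec(H(\theta),\in,\le_P)$ that satisfy $M\cap\lambda\in\lambda$. (4) $P\cap M\le_\kappa P$ for all $M\prec(H(\theta),\in,\le_P)$ that satisfy $|M|\subseteq M\cap\lambda\in\lambda$. (5) There is a club $\mathcal{E}\subseteq[P]^{<\lambda}$ such that $A\le_\kappa P$ for all $A\in\mathcal{E}$. (6) $P$ has the $(\lambda,\kappa)$-FN.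
   Context: For infinite cardinals $\lambda\ge\kappa$, a partial order $P$ has the $(\lambda,\kappa)$-FN iff there is a map $(f,g)\colon P\to[P]^{<\lambda}\times[P]^{<\kappa}$ such that for all $p\le q$ in $P$ there exist $r\in f(p)\cap g(q)$ with $p\le r\le q$ and $s\in g(p)\cap f(q)$ with $p\le s\le q$. For a subset $A$ of a partial order $P$ (with the induced order), $A\le_\kappa P$ means that for every $p\in P$ the set $A\cap{\downarrow}p=\{a\in A:a\le p\}$ has a cofinal subset of size less than $\kappa$, and the set $A\cap{\uparrow}p=\{a\in A:a\ge p\}$ has a coinitial subset of size less than $\kappa$. $H(\theta)$ is the set of all sets hereditarily of cardinality less than $\theta$; $M\prec(H(\theta),\in,\le_P)$ means that $M$ is (the universe of) an elementary submodel of this structure. ''Sufficiently large'' means that there is a cardinal $\theta_0$ depending on the data such that the assertion holds for all regular $\theta\ge\theta_0$. $[P]^{<\lambda}$ is the set of subsets of $P$ of size less than $\lambda$; a club in it is a $\subseteq$-unbounded (cofinal) subset closed under unions of increasing chains of length less than $\lambda$. Cardinals and ordinals are von Neumann ordinals, so $M\cap\lambda\in\lambda+1$ means $M\cap\lambda$ is an initial segment of $\lambda$, and $M\cap\lambda\in\lambda$ means it is a proper initial segment. *)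

(* Defs.v *)
From HB Require Import structures.
From Stdlib Require Import Relation_Operators.
From mathcomp Require Import all_boot.
From mathcomp Require Import boolp classical_sets functions cardinality.

Set Implicit Arguments.
Unset Strict Implicit.
Unset Printing Implicit Defensive.

Local Open Scope classical_set_scope.
Local Open Scope quotient_scope.
Local Open Scope card_scope.

(** [V] is Aczel's cumulative hierarchy: well-founded trees whose branching
    types live in a fixed universe, modulo bisimilarity.  Equality of sets is
    Leibniz equality ([V_ext] below), and with classical logic and choice [V]
    is a model of ZFC. *)

Inductive tree : Type := Tree (A : Type) (f : A -> tree).

Fixpoint bisim (x y : tree) : Prop :=
  let: Tree A f := x in
  let: Tree B g := y in
  (forall i, exists j, bisim (f i) (g j)) /\
  (forall j, exists i, bisim (f i) (g j)).

Lemma bisim_refl x : bisim x x.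
Proof. by elim: x => A f IH; split=> i; exists i. Qed.

Lemma bisim_sym x y : bisim x y -> bisim y x.
Proof.
elim: x y => A f IH [B g] /= [h1 h2]; split=> i.
- by have [j /IH ?] := h2 i; exists j.
- by have [j /IH ?] := h1 i; exists j.
Qed.

Lemma bisim_trans y x z : bisim x y -> bisim y z -> bisim x z.
Proof.
elim: x y z => A f IH [B g] [C h] /= [a1 a2] [b1 b2]; split=> i.
- have [j fg] := a1 i; have [k gh] := b1 j.
  by exists k; apply: IH fg gh.
- have [j gh] := b2 i; have [k fg] := a2 j.
  by exists k; apply: IH fg gh.
Qed.

HB.instance Definition _ := gen_eqMixin tree.
HB.instance Definition _ := gen_choiceMixin tree.

Definition bisimb : rel tree := fun x y => `[< bisim x y >].

Lemma bisimb_refl : reflexive bisimb.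
Proof. by move=> x; apply/asboolP/bisim_refl. Qed.

Lemma bisimb_sym : symmetric bisimb.
Proof. by move=> x y; apply/asboolP/asboolP; exact: bisim_sym. Qed.

Lemma bisimb_trans : transitive bisimb.
Proof.
by move=> y x z /asboolP xy /asboolP yz; apply/asboolP/(bisim_trans xy yz).
Qed.

Canonical bisim_equiv := EquivRel bisimb bisimb_refl bisimb_sym bisimb_trans.

Definition V : Type := {eq_quot bisim_equiv}.
HB.instance Definition _ := Choice.on V.

Definition branches (t : tree) : Type := let: Tree A _ := t in A.
Definition branch (t : tree) : branches t -> tree :=
  let: Tree A f := t in f.

(** The set [x] as the family of its elements, indexed by the small type
    [idx x]. *)
Definition idx (x : V) : Type := branches (repr x).
Definition elt (x : V) (i : idx x) : V := \pi_{eq_quot bisim_equiv} (branch i).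

Definition members (y : V) : set V := [set x | exists i : idx y, elt i = x].
Coercion members : V >-> set.
Notation "x ∈ y" := (members y x) (at level 70, no associativity).

Definition vfamily (A : Type) (f : A -> V) : V :=
  \pi_{eq_quot bisim_equiv} (Tree (fun i => repr (f i))).

Lemma pi_tree (x y : tree) :
  (\pi_{eq_quot bisim_equiv} x : V) = \pi_{eq_quot bisim_equiv} y <-> bisim x y.
Proof.
by split=> [/eqquotP /asboolP //|xy]; apply/eqquotP/asboolP.
Qed.

Lemma mem_pi (A : Type) (f : A -> tree) (x : V) :
  members (\pi_{eq_quot bisim_equiv} (Tree f)) x <->
  exists i, \pi_{eq_quot bisim_equiv} (f i) = x.
Proof.
rewrite /members /= /elt /idx.
set t := Tree f; set r := repr _.
have : bisim r t by apply/pi_tree; rewrite /r reprK.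
case: r => B g /= [h1 h2]; split=> -[i <-].
- by have [j gf] := h1 i; exists j; apply/pi_tree/bisim_sym.
- by have [j gf] := h2 i; exists j; apply/pi_tree.
Qed.

Lemma mem_vfamily (A : Type) (f : A -> V) (x : V) :
  x ∈ vfamily f <-> exists i, f i = x.
Proof.
split=> [/mem_pi [i <-]|[i <-]]; first by exists i; rewrite reprK.
by apply/mem_pi; exists i; rewrite reprK.
Qed.

Lemma V_ext (x y : V) : members x = members y -> x = y.
Proof.
move=> xy; rewrite -[x]reprK -[y]reprK; apply/pi_tree.
have : forall z, members x z <-> members y z by move=> z; rewrite xy.
rewrite /members /= /elt /idx.
case: (repr x) => A f; case: (repr y) => B g /= h; split=> [i|j].
- have [j e] := (h (\pi_{eq_quot bisim_equiv} (f i))).1 (ex_intro _ i erefl).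
  by exists j; apply/bisim_sym/pi_tree.
- have [i e] := (h (\pi_{eq_quot bisim_equiv} (g j))).2 (ex_intro _ j erefl).
  by exists i; apply/pi_tree.
Qed.

Lemma mem_wf : well_founded (fun x y : V => x ∈ y).
Proof.
move=> x; rewrite -[x]reprK; elim: (repr x) => A f IH.
by constructor=> y /mem_pi [i <-]; exact: IH.
Qed.

Definition vempty : V := vfamily (fun i : Empty_set => match i with end).

Definition vinter (x y : V) : V :=
  vfamily (fun i : {i : idx x | elt i ∈ y} => elt (sval i)).

Lemma mem_vinter (x y z : V) : z ∈ vinter x y <-> z ∈ x /\ z ∈ y.
Proof.
split=> [/mem_vfamily [[i iy] /= <-]|[[i iz] zy]]; first by split=> //; exists i.
by subst z; apply/mem_vfamily; exists (exist _ i zy).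
Qed.

Definition vsucc (x : V) : V :=
  vfamily (fun o : option (idx x) => if o is Some i then elt i else x).

Lemma mem_vsucc (x z : V) : z ∈ vsucc x <-> z ∈ x \/ z = x.
Proof.
split=> [/mem_vfamily [[i|] <-]|]; [by left; exists i|by right|].
by case=> [[i <-]|->]; apply/mem_vfamily; [exists (Some i)|exists None].
Qed.

Definition card_lt T U (A : set T) (B : set U) : Prop :=
  A #<= B /\ ~ (B #<= A).
Notation "A '#<' B" := (card_lt A B) (at level 79) : card_scope.

Definition transitive_set (x : V) : Prop := forall y, y ∈ x -> y `<=` x.

Definition is_ordinal (a : V) : Prop :=
  [/\ transitive_set a,
      forall x, x ∈ a -> ~ x ∈ x,
      forall x y z, x ∈ a -> y ∈ a -> z ∈ a -> x ∈ y -> y ∈ z -> x ∈ z &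
      forall A : set V, A `<=` a -> A !=set0 ->
        exists2 m, A m & forall x, A x -> m = x \/ m ∈ x].

Definition is_cardinal (k : V) : Prop :=
  is_ordinal k /\ forall a, a ∈ k -> ~ (a #= k).

(** The von Neumann cardinal of [x]; the default [vempty] is never used, since
    by choice every set is equinumerous with a cardinal. *)
Definition vcard (x : V) : V := xget vempty [set k | is_cardinal k /\ k #= x].

Definition cofinal T (le : T -> T -> Prop) (B A : set T) : Prop :=
  B `<=` A /\ forall a, A a -> exists2 b, B b & le a b.

Definition coinitial T (le : T -> T -> Prop) (B A : set T) : Prop :=
  cofinal (fun x y => le y x) B A.

(** Ordinals are ordered by inclusion; regularity says that the cofinality of
    [k] is [k]. *)
Definition is_regular (k : V) : Prop :=
  [/\ is_cardinal k, infinite_set k &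
      forall A : set V, cofinal (fun a b : V => a `<=` b) A k -> ~ (A #< k)].

(** [le] is a relation on [P] only, like a set of pairs included in [P * P]. *)
Definition is_partial_order T (P : set T) (le : T -> T -> Prop) : Prop :=
  [/\ forall x y, le x y -> P x /\ P y,
      forall x, P x -> le x x,
      forall x y, le x y -> le y x -> x = y &
      forall x y z, le x y -> le y z -> le x z].

Definition subsets_lt T (P : set T) (l : V) : set (set T) :=
  [set A | A `<=` P /\ A #< l].

Definition has_FN (l k : V) T (P : set T) (le : T -> T -> Prop) : Prop :=
  exists f g : T -> set T,
    (forall p, P p -> subsets_lt P l (f p) /\ subsets_lt P k (g p)) /\
    (forall p q, P p -> P q -> le p q ->
      (exists r, [/\ f p r, g q r, le p r & le r q]) /\
      (exists s, [/\ g p s, f q s, le p s & le s q])).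

Definition le_kappa (k : V) T (le : T -> T -> Prop) (A P : set T) : Prop :=
  forall p, P p ->
    (exists2 C, cofinal le C (A `&` [set a | le a p]) & C #< k) /\
    (exists2 C, coinitial le C (A `&` [set a | le p a]) & C #< k).

(** Chains are indexed by nonzero ordinals below [l]. *)
Definition is_club T (P : set T) (l : V) (E : set (set T)) : Prop :=
  [/\ E `<=` subsets_lt P l,
      forall A, subsets_lt P l A -> exists2 B, E B & A `<=` B &
      forall (d : V) (A : V -> set T), d ∈ l -> d !=set0 ->
        (forall a, a ∈ d -> E (A a)) ->
        (forall a b, a ∈ d -> b ∈ d -> a ∈ b -> A a `<=` A b) ->
        E (\bigcup_(a in d) A a)].

Definition trcl (x : V) : set V :=
  [set y | clos_trans V (fun u v => u ∈ v) y x].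

Definition Hset (theta : V) : set V := [set x | trcl x #< theta].

(** First-order formulas with equality in the language with two binary relation
    symbols; variables are named by natural numbers. *)
Inductive formula : Type :=
| FEq (i j : nat)
| FIn (i j : nat)
| FLe (i j : nat)
| FNot (phi : formula)
| FAnd (phi psi : formula)
| FEx (i : nat) (phi : formula).

(** [D] is the universe of the structure: quantifiers range over [D], and the
    symbol of [FLe] is interpreted by [le]. *)
Fixpoint sat (le : V -> V -> Prop) (D : set V) (phi : formula) (e : nat -> V) :
    Prop :=
  match phi with
  | FEq i j => e i = e j
  | FIn i j => e i ∈ e j
  | FLe i j => le (e i) (e j)
  | FNot phi => ~ sat le D phi e
  | FAnd phi psi => sat le D phi e /\ sat le D psi e
  | FEx i phi => exists2 x, D x & sat le D phi [eta e with i |-> x]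
  end.

Definition elementary (le : V -> V -> Prop) (M D : set V) : Prop :=
  [/\ M !=set0, M `<=` D &
      forall (phi : formula) (e : nat -> V), (forall i, M (e i)) ->
        (sat le M phi e <-> sat le D phi e)].

(* Main.v *)
(** The implications that need work are (4) -> (6), (5) -> (6), (6) -> (5) and
    (6) -> (1).

    (4) -> (6) and (5) -> (6).  Both provide a cofinal family of subsets [N] of
    some [X] including [P], with [P] ∩ [N] ≤_κ [P], closed under unions of chains
    of length at most κ (small elementary submodels, resp. the members of the
    club).  Choosing members of the family monotonically for finite subsets of
    [X] gives a set-valued [F] such that [P] ∩ [N] ≤_κ [P] for every [F]-closed
    [N] of any size: otherwise a κ-sequence in [N], none of whose terms is below
    an element of the hull of its predecessors, generates a member of the family
    refuting ≤_κ.  Then [P] ∩ [N] has the FN for all [F]-closed [N] by induction on |[N]|,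
    gluing along a continuous filtration of [N] by smaller [F]-closed sets.
    Passing through (6) matters: the models of (4) need not contain a club.

    (6) -> (5).  The subsets of [P] closed under [f] form the club.

    (6) -> (1).  Neither λ nor κ need belong to [M].  Either [P] is included in
    [M], or [M] has a least ordinal [L] outside λ.  Then [M] ∩ [L] = [M] ∩ λ, and [M]
    contains an (L,K)-FN of [P] with [K] minimal, so that [K] ≤ κ.  For [a] in [M]
    one gets [f a] included in [M], so [g p] ∩ [M] contains the required cofinal and
    coinitial sets. *)

From HB Require Import structures.
Require Import Defs.
From Stdlib Require Import Relation_Operators Inverse_Image.
From mathcomp Require Import all_boot finmap.
From mathcomp Require Import boolp classical_sets functions cardinality.

Set Implicit Arguments.
Unset Strict Implicit.
Unset Printing Implicit Defensive.

Local Open Scope classical_set_scope.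
Local Open Scope card_scope.

(** * Comparison of cardinalities *)

Lemma cle_fun T U (A : set T) (B : set U) (f : T -> U) :
  (forall x, A x -> B (f x)) ->
  (forall x y, A x -> A y -> f x = f y -> x = y) -> A #<= B.
Proof.
move=> fB fI.
suff /injfunPex/unsquash g : exists2 g : T -> U, set_fun A B g & set_inj A g.
  exact: inj_card_le g.
by exists f => // x y /set_mem Ax /set_mem Ay; exact: fI.
Qed.

Lemma cle_inv T U (u0 : U) (A : set T) (B : set U) : A #<= B ->
  exists f : T -> U, (forall x, A x -> B (f x)) /\
    (forall x y, A x -> A y -> f x = f y -> x = y).
Proof.
(* The point [u0] provides the values outside [A] of a total function. *)
pose U' : pointedType := HB.pack U (isPointed.Build U u0) (gen_eqMixin U)
  (gen_choiceMixin U).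
move=> /(@pcard_leP T U') /unsquash f; exists f; split=> [x Ax|x y Ax Ay].
  exact: (@funS _ _ _ _ f).
by apply: (@inj _ _ _ f); exact/mem_set.
Qed.

Lemma cle_surj T U (A : set T) (B : set U) (f : U -> T) :
  (forall x, A x -> exists2 y, B y & f y = x) -> A #<= B.
Proof.
move=> fs; case: (pselect (A = set0)) => [->|/eqP/set0P[a0 Aa0]].
  exact: card_ge0.
have [u0 _ _] := fs _ Aa0.
have /choice [g gP] : forall x, exists y, A x -> B y /\ f y = x.
  move=> x; case: (pselect (A x)) => [/fs[y By fy]|nA]; first by exists y.
  by exists u0.
apply: (@cle_fun _ _ _ _ g) => [x /gP[]//|x y /gP[_ e] /gP[_ e'] gg].
by rewrite -e -e' gg.
Qed.

Lemma cle_lt_trans T U W (A : set T) (B : set U) (C : set W) :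
  A #<= B -> B #< C -> A #< C.
Proof.
move=> AB [BC nCB]; split; first exact: card_le_trans BC.
by move=> CA; apply: nCB; apply: card_le_trans AB.
Qed.

Lemma clt_le_trans T U W (A : set T) (B : set U) (C : set W) :
  A #< B -> B #<= C -> A #< C.
Proof.
move=> [AB nBA] BC; split; first exact: card_le_trans BC.
by move=> CA; apply: nBA; apply: card_le_trans CA.
Qed.

(** Zorn's lemma gives a maximal partial injection [G] from [A] to [B], taken as a graph. If it
    missed both some [a] in [A] and some [b] in [B], the pair [(a, b)] could be added; so [G] or its
    inverse is total. *)
Lemma card_comparable T U (A : set T) (B : set U) : A #<= B \/ B #<= A.
Proof.
pose ok (G : set (T * U)) := [/\ forall z, G z -> A z.1 /\ B z.2,
  forall z z', G z -> G z' -> z.1 = z'.1 -> z = z' &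
  forall z z', G z -> G z' -> z.2 = z'.2 -> z = z'].
have [|G [Gok Gmax]] := @Zorn_bigcup _ ok.
  move=> F Fok Ftot; split=> [z [G /Fok[h _ _] /h]//|z z' [G FG Gz] [G' FG' Gz']|].
    have [_ + _] := Fok _ FG'; have [_ + _] := Fok _ FG.
    by have [s|s] := Ftot _ _ FG FG' => h h'; [apply: h' => //|apply: h => //];
      apply: s.
  move=> z z' [G FG Gz] [G' FG' Gz'].
  have [_ _ +] := Fok _ FG'; have [_ _ +] := Fok _ FG.
  by have [s|s] := Ftot _ _ FG FG' => h h'; [apply: h' => //|apply: h => //];
    apply: s.
have [GAB Gf Gi] := Gok.
case: (pselect (forall a, A a -> exists b, G (a, b))) => [full|/existsNP[a]].
  left; case: (pselect (A = set0)) => [->|/eqP/set0P[a0 /full[u0 _]]].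
    exact: card_ge0.
  have /choice [g gP] : forall x, exists y, A x -> G (x, y).
    move=> x; case: (pselect (A x)) => [/full[y]|nA]; first by exists y.
    by exists u0.
  apply: (@cle_fun _ _ _ _ g) => [x /gP/GAB[]//|x y /gP h /gP h' gg].
  by have [] := Gi _ _ h h' gg.
move=> /not_implyP[Aa nGa]; right.
have full b : B b -> exists x, G (x, b).
  move=> Bb; apply: contrapT => nGb; apply: (Gmax (G `|` [set (a, b)])).
    split; last by move=> /(_ (a, b) (or_intror erefl)) h; apply: nGa; exists b.
    by left.
  split=> [z [/GAB//|->//]|z z'|z z'].
    move=> [Gz|->] [Gz'|->] //=; first exact: Gf.
      by move=> e; case: nGa; exists z.2; rewrite -e -surjective_pairing.
    by move=> e; case: nGa; exists z'.2; rewrite e -surjective_pairing.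
  move=> [Gz|->] [Gz'|->] //=; first exact: Gi.
    by move=> e; case: nGb; exists z.1; rewrite -e -surjective_pairing.
  by move=> e; case: nGb; exists z'.1; rewrite e -surjective_pairing.
have /choice [g gP] : forall y, exists x, B y -> G (x, y).
  move=> y; case: (pselect (B y)) => [/full[x]|nB]; first by exists x.
  by exists a.
apply: (@cle_fun _ _ _ _ g) => [y /gP/GAB[]//|x y /gP h /gP h' gg].
by have [] := Gf _ _ h h' gg.
Qed.

Lemma cle_onto T U (a0 : T) (A : set T) (B : set U) : A a0 -> A #<= B ->
  exists f : U -> T, (forall y, A (f y)) /\ forall x, A x -> exists2 y, B y & f y = x.
Proof.
move=> Aa0; case: (pselect (B = set0)) => [->|/eqP/set0P[u0 _]].
  by move=> /card_le0P A0; move: Aa0; rewrite A0.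
move=> /(cle_inv u0)[g [gB gI]].
have /choice [f fP] : forall y, exists x, A x /\ ((exists2 x', A x' & g x' = y) -> g x = y).
  move=> y; case: (pselect (exists2 x', A x' & g x' = y)) => [[x Ax xy]|n].
    by exists x.
  by exists a0.
exists f; split=> [y|x Ax]; first by case: (fP y).
exists (g x); first exact: gB.
by have [Af /(_ (ex_intro2 _ _ x Ax erefl))] := fP (g x); exact: gI.
Qed.

Lemma bigcup_cle J T U (I : set J) (A : J -> set T) (B : set U) (C : set U) :
  I #<= B -> (forall i, I i -> A i #<= C) -> \bigcup_(i in I) A i #<= B `*` C.
Proof.
move=> IB AC; case: (pselect (\bigcup_(i in I) A i = set0)) => [->|].
  exact: card_ge0.
move=> /eqP/set0P[x0 [i0 Ii0 Ai0]].
have [h [hI hs]] := cle_onto Ii0 IB.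
have /choice [g gP] : forall i, exists g : U -> T, I i ->
    forall x, A i x -> exists2 y, C y & g y = x.
  move=> i; case: (pselect (I i /\ A i !=set0)) => [[Ii [a0 Aa0]]|n].
    by have [g [_ gs]] := cle_onto Aa0 (AC _ Ii); exists g.
  exists (fun=> x0) => Ii x Ax; case: n; split=> //; by exists x.
apply: (@cle_surj _ _ _ _ (fun z => g (h z.1) z.2)) => x [i Ii Ax].
have [u Bu ui] := hs _ Ii; have [y Cy yx] := gP _ Ii _ Ax.
by exists (u, y) => //=; rewrite ui.
Qed.

Lemma setX_cle T U T' U' (A : set T) (B : set U) (A' : set T') (B' : set U') :
  A #<= A' -> B #<= B' -> A `*` B #<= A' `*` B'.
Proof.
move=> AA BB; case: (pselect (A `*` B = set0)) => [->|]; first exact: card_ge0.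
move=> /eqP/set0P[[a0 b0] [/= Aa0 Bb0]].
have [f [_ fs]] := cle_onto Aa0 AA; have [g [_ gs]] := cle_onto Bb0 BB.
apply: (@cle_surj _ _ _ _ (fun z => (f z.1, g z.2))) => -[a b] [/= Aa Bb].
have [y Ay yx] := fs _ Aa; have [z Bz zx] := gs _ Bb.
by exists (y, z) => //=; rewrite yx zx.
Qed.

(** * Ordinals and cardinals *)

Lemma mem_irr (x : V) : ~ x ∈ x.
Proof. by elim/(well_founded_ind mem_wf): x => x IH xx; exact: (IH _ xx xx). Qed.

Lemma mem_min (A : set V) : A !=set0 -> exists2 m, A m & forall y, y ∈ m -> ~ A y.
Proof.
move=> [x Ax]; apply: contrapT => nm.
suff: forall x, ~ A x by move=> /(_ _ Ax).
elim/(well_founded_ind mem_wf) => z IH Az.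
by apply: nm; exists z => // y /IH.
Qed.

(** Foundation gives irreflexivity and minimal elements for free. What is left is to compare a
    minimal element with the others, and this trichotomy follows by a double ∈-induction. *)
Lemma ordinal_of_transitive (a : V) :
  transitive_set a -> (forall x, x ∈ a -> transitive_set x) -> is_ordinal a.
Proof.
move=> ta tx; split=> //.
- by move=> x _; exact: mem_irr.
- by move=> x y z _ _ za xy yz; exact: (tx _ za _ yz _ xy).
move=> A Aa A0; have [m Am mmin] := mem_min A0; exists m => // x.
have : forall x y, x ∈ a -> y ∈ a -> [\/ x ∈ y, x = y | y ∈ x].
  elim/(well_founded_ind mem_wf) => u IHu; elim/(well_founded_ind mem_wf) => v IHv ua va.
  case: (pselect (u ∈ v)) => uv; first by constructor 1.
  case: (pselect (v ∈ u)) => vu; first by constructor 3.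
  constructor 2; apply: V_ext; apply/seteqP; split=> w wu.
    have [//| e |h] := IHu _ wu v (ta _ ua _ wu) va.
      by move: vu; rewrite -e.
    by case: vu; exact: (tx _ ua _ wu _ h).
  have [h| e |//] := IHv _ wu ua (ta _ va _ wu).
    by case: uv; exact: (tx _ va _ wu _ h).
  by move: uv; rewrite e.
move=> tri Ax; have [h|h|h] := tri _ _ (Aa _ Am) (Aa _ Ax).
- by right.
- by left.
- by case: (mmin _ h).
Qed.

Lemma ordinal_transitive (a x : V) : is_ordinal a -> x ∈ a -> transitive_set x.
Proof.
move=> [ta _ h _] xa y yx z zy.
by apply: (h z y x) => //; [exact: (ta y (ta _ xa _ yx))|exact: (ta _ xa)].
Qed.

Lemma mem_ordinal (a x : V) : is_ordinal a -> x ∈ a -> is_ordinal x.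
Proof.
move=> oa xa; apply: ordinal_of_transitive; first exact: ordinal_transitive xa.
move=> y yx; apply: (ordinal_transitive oa); have [ta _ _ _] := oa; exact: (ta _ xa).
Qed.

Lemma ordinal_trichotomy (a b : V) : is_ordinal a -> is_ordinal b ->
  [\/ a ∈ b, a = b | b ∈ a].
Proof.
move: a b; elim/(well_founded_ind mem_wf) => u IHu.
elim/(well_founded_ind mem_wf) => v IHv ou ov.
case: (pselect (u ∈ v)) => uv; first by constructor 1.
case: (pselect (v ∈ u)) => vu; first by constructor 3.
have [tu _ _ _] := ou; have [tv _ _ _] := ov.
constructor 2; apply: V_ext; apply/seteqP; split=> w wu.
  have [//| e |h] := IHu _ wu v (mem_ordinal ou wu) ov.
    by move: vu; rewrite -e.
  by case: vu; exact: (tu _ wu _ h).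
have [h| e |//] := IHv _ wu ou (mem_ordinal ov wu).
  by case: uv; exact: (tv _ wu _ h).
by move: uv; rewrite e.
Qed.

Lemma ordinal_sub (a b : V) : is_ordinal a -> is_ordinal b ->
  a `<=` b -> a ∈ b \/ a = b.
Proof.
move=> oa ob ab; have [h|h|h] := ordinal_trichotomy oa ob; [by left|by right|].
by case: (mem_irr (ab _ h)).
Qed.

Lemma ordinal_notin (a b : V) : is_ordinal a -> is_ordinal b -> ~ b ∈ a -> a `<=` b.
Proof.
move=> oa ob nba; have [h|->|//] := ordinal_trichotomy oa ob => //.
by have [tb _ _ _] := ob; exact: tb.
Qed.

Lemma ordinal_total (a b : V) : is_ordinal a -> is_ordinal b -> a `<=` b \/ b `<=` a.
Proof.
move=> oa ob; case: (pselect (b ∈ a)) => [ba|/ordinal_notin h]; last by left; exact: h.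
by right; have [ta _ _ _] := oa; exact: ta.
Qed.

(** An instance of replacement: through a surjection from [x] to [A], the index type of [x] also
    indexes [A]. *)
Lemma small_set (A : set V) (x : V) : A #<= x -> exists y : V, members y = A.
Proof.
case: (pselect (A = set0)) => [-> _|/eqP/set0P[a0 Aa0]].
  by exists vempty; apply/seteqP; split=> // z /mem_vfamily[[]].
move=> /(cle_onto Aa0)[f [fA fs]].
exists (vfamily (fun i : idx x => f (elt i))); apply/seteqP; split=> z.
  by move=> /mem_vfamily[i <-]; exact: fA.
by move=> /fs[y [i <-] <-]; apply/mem_vfamily; exists i.
Qed.

(** The Mostowski collapse, by recursion along [R]. Extensionality of [R] is not assumed, so
    distinct points may be identified. *)
Lemma collapse (T : Type) (R : T -> T -> Prop) : well_founded R ->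
  exists pi : T -> V, forall w x, x ∈ pi w <-> exists2 w', R w' w & pi w' = x.
Proof.
move=> wfR.
pose step w (rec : forall w', R w' w -> V) :=
  vfamily (fun s : {w' | R w' w} => rec (sval s) (svalP s)).
exists (Fix wfR (fun=> V) step) => w x.
rewrite Fix_eq; last first.
  move=> u f g fg; congr vfamily; apply/funext => -[s sP] /=; exact: fg.
split=> [/mem_vfamily[[w' Rw] /= <-]|[w' Rw <-]]; first by exists w'.
by apply/mem_vfamily; exists (exist _ w' Rw).
Qed.

Lemma collapse_ordinal (T : Type) (R : T -> T -> Prop) (pi : T -> V) :
  (forall u v w, R u v -> R v w -> R u w) ->
  (forall w x, x ∈ pi w <-> exists2 w', R w' w & pi w' = x) ->
  forall w, is_ordinal (pi w).
Proof.
move=> Rt piE.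
have tr w : transitive_set (pi w).
  move=> y /piE[v Rv <-] z /piE[u Ru <-]; apply/piE; exists u => //.
  exact: Rt Rv.
move=> w; apply: ordinal_of_transitive => // x /piE[v _ <-]; exact: tr.
Qed.

Lemma ordinal_vfamily (T : Type) (R : T -> T -> Prop) (pi : T -> V) :
  (forall u v w, R u v -> R v w -> R u w) ->
  (forall w x, x ∈ pi w <-> exists2 w', R w' w & pi w' = x) ->
  is_ordinal (vfamily pi).
Proof.
move=> Rt piE; apply: ordinal_of_transitive.
  move=> y /mem_vfamily[w <-] z /piE[v _ <-]; apply/mem_vfamily; by exists v.
move=> y /mem_vfamily[w <-]; have [t _ _ _] := collapse_ordinal Rt piE w; exact: t.
Qed.

(** The order type of [S] is the collapse of membership restricted to [S]. *)
Lemma sub_ordinal_type (S : set V) (a : V) : is_ordinal a -> S `<=` a ->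
  exists b : V, [/\ is_ordinal b, S #<= b & b #<= S].
Proof.
move=> oa Sa.
pose T := {i : idx a | S (elt i)}.
pose val (t : T) := elt (sval t).
pose R (s t : T) := val s ∈ val t.
have wfR : well_founded R by exact: (wf_inverse_image _ _ _ _ mem_wf).
have ordS x : S x -> is_ordinal x by move=> /Sa; exact: mem_ordinal.
have [pi piE] := collapse wfR.
have Rt u v w : R u v -> R v w -> R u w.
  move=> uv vw; have [t _ _ _] := ordS _ (svalP w); exact: (t _ vw).
(* An element may have several indices, so equal collapses give equal values rather than equal
   indices. *)
have Rtri u v : pi u = pi v -> val u = val v.
  have [h e|//|h e] := ordinal_trichotomy (ordS _ (svalP u)) (ordS _ (svalP v)).
    have : pi u ∈ pi v by apply/piE; exists u.
    by rewrite e => /mem_irr.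
  have : pi v ∈ pi u by apply/piE; exists v.
  by rewrite e => /mem_irr.
exists (vfamily pi); split; first exact: (ordinal_vfamily Rt piE).
  have /choice [t tP] : forall x, exists t : option T, S x -> exists2 t', t = Some t' & val t' = x.
    move=> x; case: (pselect (S x)) => [Sx|n]; last by exists None.
    have [i ix] := Sa _ Sx; move: (Sx); rewrite -ix => Si.
    by exists (Some (exist _ i Si)) => _; exists (exist _ i Si).
  apply: (@cle_fun _ _ _ _ (fun x => if t x is Some t' then pi t' else vempty)).
    by move=> x /tP[t' -> _]; apply/mem_vfamily; exists t'.
  by move=> x y /tP[t' -> <-] /tP[u -> <-] /Rtri.
case: (pselect (S = set0)) => [S0|/eqP/set0P[s0 Ss0]].
  suff -> : members (vfamily pi) = set0 by exact: card_ge0.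
  by apply/seteqP; split=> // z /mem_vfamily[[i Si] _]; rewrite S0 in Si.
have /choice [g gP] : forall x, exists y, S x -> exists2 t : T, val t = x & y = pi t.
  move=> x; case: (pselect (S x)) => [Sx|n]; last by exists vempty.
  have [i ix] := Sa _ Sx; move: (Sx); rewrite -ix => Si.
  by exists (pi (exist _ i Si)) => _; exists (exist _ i Si).
apply: (@cle_surj _ _ _ _ g) => z /mem_vfamily[t <-]; exists (val t).
  exact: svalP t.
have [t' tt ->] := gP _ (svalP t).
apply: V_ext; apply/seteqP; split=> x /piE[w Rw <-]; apply/piE; exists w => //;
by move: Rw; rewrite /R tt.
Qed.

(** Let [k] be the least ordinal into which [A] injects. The image of [A] in [k] has an order type
    [b] of the same size as [A], and minimality forces [k] to be included in [b]. *)
Lemma ordinal_cle_card T (A : set T) (a : V) : is_ordinal a -> A #<= a ->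
  exists k, [/\ is_cardinal k, A #<= k & k #<= A].
Proof.
move=> oa Aa.
have [|k [ok Ak] kmin] := @mem_min [set b | is_ordinal b /\ A #<= b].
  by exists a.
suff kA : k #<= A.
  exists k; split=> //; split=> // b bk bE; apply: (kmin _ bk).
  split; first exact: mem_ordinal bk.
  by have /card_eqPle[_ kb] := bE; apply: card_le_trans kb.
have [f [fk fI]] := cle_inv vempty Ak.
have [|b [ob Sb bS]] := @sub_ordinal_type (f @` A) _ ok.
  by move=> _ [x /fk fx <-].
have kb : k `<=` b.
  apply: ordinal_notin => // bk; apply: (kmin _ bk); split=> //.
  apply: card_le_trans Sb; apply: (@cle_fun _ _ _ _ f) => // x Ax; by exists x.
apply: (card_le_trans (subset_card_le kb)); apply: (card_le_trans bS).
exact: card_image_le.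
Qed.

(** Hartogs' argument. An ordinal that injects into [x] is the collapse of a well-founded transitive
    relation on a subtype of [idx x]. These relations form a small type, so the ordinals in question
    form a set [h], again an ordinal. It does not inject into [x], since otherwise [h ∈ h]. *)
Lemma hartogs (x : V) : exists2 k, is_cardinal k & members x #< k.
Proof.
pose I := {S : idx x -> Prop & {R : {i | S i} -> {i | S i} -> Prop |
  well_founded R /\ forall u v w, R u v -> R v w -> R u w}}.
have Hpi : forall r : I, exists pi : {i | projT1 r i} -> V,
    forall w y, y ∈ pi w <-> exists2 w', sval (projT2 r) w' w & pi w' = y.
  by move=> [S [R [wfR tR]]]; exact: collapse.
pose pi r := projT1 (cid (Hpi r)).
have piE r w y : y ∈ pi r w <-> exists2 w', sval (projT2 r) w' w & pi r w' = y.
  exact: (projT2 (cid (Hpi r)) w y).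
pose ot r := vfamily (pi r).
(* As [idx x] may list elements of [x] repeatedly, an order type [ot r] need not inject into [x];
   the subtype keeps those that do. *)
pose h := vfamily (fun r : {r : I | ot r #<= x} => ot (sval r)).
have hE a : a ∈ h <-> is_ordinal a /\ a #<= x.
  split=> [/mem_vfamily[[r rx] /= <-]|[oa ax]].
    split=> //; apply: (ordinal_vfamily _ (piE r)); by have [] := svalP (projT2 r).
  have [f [fx fI]] := cle_inv vempty ax.
  pose S (i : idx x) := exists2 y, y ∈ a & f y = elt i.
  have /choice [val valP] : forall t : {i | S i}, exists y, y ∈ a /\ f y = elt (sval t).
    by move=> [i [y ya yi]]; exists y.
  pose R (s t : {i | S i}) := val s ∈ val t.
  have RP : well_founded R /\ forall u v w, R u v -> R v w -> R u w.
    split; first exact: (wf_inverse_image _ _ _ _ mem_wf).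
    move=> u v w uv vw; have [t _ _ _] := mem_ordinal oa (valP w).1.
    exact: (t _ vw).
  pose r : I := existT _ S (exist _ R RP).
  (* An element of an ordinal is the set of its predecessors, so the collapse gives back the
     values. *)
  have piv t : pi r t = val t.
    elim/(well_founded_ind RP.1): t => t IH; apply: V_ext; apply/seteqP; split=> z.
      by move=> /piE[s st <-]; rewrite IH.
    move=> zt; have za : z ∈ a.
      by have [ta _ _ _] := oa; exact: (ta _ (valP t).1).
    have [i iz] := fx _ za.
    have Si : S i by exists z.
    have vz : val (exist _ i Si) = z.
      have [va fv] := valP (exist _ i Si); apply: fI => //; by rewrite fv.
    have Rt : R (exist _ i Si) t by rewrite /R vz.
    by apply/piE; exists (exist _ i Si) => //; rewrite IH.
  have otr : ot r = a.
    apply: V_ext; apply/seteqP; split=> z; first by move=> /mem_vfamily[t <-]; rewrite piv; case: (valP t).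
    move=> za; have [i iz] := fx _ za.
    have Si : S i by exists z.
    have vz : val (exist _ i Si) = z.
      have [va fv] := valP (exist _ i Si); apply: fI => //; by rewrite fv.
    by apply/mem_vfamily; exists (exist _ i Si); rewrite piv.
  have rx : ot r #<= x by rewrite otr.
  by apply/mem_vfamily; exists (exist _ r rx).
have oh : is_ordinal h.
  apply: ordinal_of_transitive => [a /hE[oa ax] b ba|a /hE[[]//]].
  apply/hE; split; first exact: mem_ordinal ba.
  by apply: card_le_trans ax; apply: subset_card_le; have [ta _ _ _] := oa; exact: ta.
have nhx : ~ (h #<= x) by move=> hx; apply: (@mem_irr h); apply/hE.
exists h.
  split=> // a /hE[oa ax]; move=> /card_eqPle[_ ha]; apply: nhx.
  exact: card_le_trans ax.
by split=> //; have [] := card_comparable x h.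
Qed.

Lemma small_card T (A : set T) (x : V) : A #<= x ->
  exists k, [/\ is_cardinal k, A #<= k & k #<= A].
Proof.
move=> Ax; have [h [oh _] [xh _]] := hartogs x.
by apply: (ordinal_cle_card oh); apply: card_le_trans xh.
Qed.

Lemma cardinal_clt (k a : V) : is_cardinal k -> a ∈ k -> members a #< k.
Proof.
move=> [ok kmin] ak.
have ale : a #<= k by apply: subset_card_le; have [tk _ _ _] := ok; exact: tk.
by split=> // ka; apply: (kmin _ ak); apply/card_eqPle.
Qed.

Lemma cardinal_sub (k a : V) : is_cardinal k -> is_ordinal a -> k #<= a -> k `<=` a.
Proof.
move=> ck oa ka; have [ok _] := ck; apply: ordinal_notin => // /(cardinal_clt ck)[_].
exact.
Qed.

Lemma clt_cardinal T (A : set T) (k : V) : is_cardinal k -> A #< k ->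
  exists a, [/\ a ∈ k, is_cardinal a, A #<= a & a #<= A].
Proof.
move=> ck [Ak nkA]; have [a [ca Aa aA]] := small_card Ak.
exists a; split=> //; have [ok _] := ck; have [oa _] := ca.
apply: contrapT => nak; apply: nkA; apply: card_le_trans aA.
apply: subset_card_le; exact: ordinal_notin.
Qed.

Lemma cle_clt_total T U (A : set T) (B : set U) : A #<= B \/ B #< A.
Proof.
case: (pselect (A #<= B)) => h; first by left.
by right; split=> //; have [] := card_comparable A B.
Qed.

Lemma finite_clt T U (A : set T) (B : set U) :
  finite_set A -> infinite_set B -> A #< B.
Proof.
move=> fA iB; have [BA|//] := cle_clt_total B A.
by case: iB; apply: card_le_finite fA.
Qed.

Lemma infinite_cle T U (A : set T) (B : set U) :
  infinite_set A -> A #<= B -> infinite_set B.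
Proof. by move=> iA AB fB; apply: iA; apply: card_le_finite fB. Qed.

(** Hilbert's hotel: [x] goes to the first term of a sequence of distinct elements of [A], each term
    goes to the next one, and everything else stays fixed. *)
Lemma infinite_setU1 T (A : set T) (x : T) : infinite_set A -> x |` A #<= A.
Proof.
move=> /infiniteP; case: (pselect (A x)) => [Ax _|nAx].
  by apply: subset_card_le => y [->|].
move=> /(cle_inv x)[g [gA gI]].
pose f y := if pselect (y = x) is left _ then g 0%N else
  if pselect (exists n, g n = y) is left h then g (sval (cid h)).+1 else y.
have gI' m n : g m = g n -> m = n by exact: gI.
have fE n : f (g n) = g n.+1.
  rewrite /f; case: pselect => [e|_]; first by case: nAx; rewrite -e; exact: gA.
  case: pselect => [h|[]]; last by exists n.
  by congr (g _.+1); apply: gI'; rewrite (svalP (cid h)).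
have fx : f x = g 0%N by rewrite /f; case: pselect.
have fo y : y <> x -> (forall n, g n <> y) -> f y = y.
  move=> yx ny; rewrite /f; case: pselect => // _; case: pselect => // -[n gn].
  by case: (ny n).
have cases y : (x |` A) y -> [\/ y = x, exists n, y = g n |
    [/\ A y, f y = y & forall n, g n <> y]].
  move=> Ay; case: (pselect (y = x)) => yx; first by constructor 1.
  case: (pselect (exists n, g n = y)) => [[n <-]|/forallNP ny].
    by constructor 2; exists n.
  by constructor 3; split; [case: Ay|exact: fo|].
apply: (@cle_fun _ _ _ _ f) => [y /cases[->|[n ->]|[Ay -> //]]|y z].
- by rewrite fx; exact: gA.
- by rewrite fE; exact: gA.
move=> /cases[->|[n ->]|[Ay fy ny]] /cases[->|[m ->]|[Az fz nz]] //.
- by rewrite fx fE => /gI'.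
- by rewrite fx fz => e; case: (nz 0%N).
- by rewrite fx fE => /gI'.
- by rewrite !fE => /gI'[->].
- by rewrite fz fE => e; case: (nz n.+1).
- by rewrite fx fy => e; case: (ny 0%N).
- by rewrite fy fE => e; case: (ny m.+1).
- by rewrite fy fz.
Qed.

(** Goedel's ordering of pairs (by maximum, then lexicographically): initial
    segments are smaller than [k], so its collapse is at most [k]. *)
Lemma cardinal_sqr (k : V) : is_cardinal k -> infinite_set k ->
  members k `*` members k #<= k.
Proof.
elim/(well_founded_ind mem_wf): k => k IH ck ik; have [ok _] := ck.
have [tk _ _ _] := ok.
have ordk a : a ∈ k -> is_ordinal a by exact: mem_ordinal.
pose mx (p : V * V) := if pselect (p.1 `<=` p.2) is left _ then p.2 else p.1.
pose r (p q : V * V) := mx p ∈ mx q \/ mx p = mx q /\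
  (p.1 ∈ q.1 \/ p.1 = q.1 /\ p.2 ∈ q.2).
have wfr : well_founded r.
  suff h m : forall a b, mx (a, b) = m -> Acc r (a, b) by move=> [a b]; exact: (h _ _ _ erefl).
  elim/(well_founded_ind mem_wf): m => m IHm.
  elim/(well_founded_ind mem_wf) => a IHa; elim/(well_founded_ind mem_wf) => b IHb abm.
  constructor=> -[c d] [/=|[/= e [h|[ce h]]]].
  - by rewrite abm => h; exact: (IHm _ h).
  - by apply: (IHa _ h); rewrite e.
  - by rewrite ce; apply: (IHb _ h); rewrite -abm -e ce.
have mxk p : p.1 ∈ k -> p.2 ∈ k -> mx p ∈ k by rewrite /mx; case: pselect.
have mx1 p : p.1 ∈ k -> p.2 ∈ k -> p.1 `<=` mx p.
  by rewrite /mx; case: pselect => // _ _ _; exact: subset_refl.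
have mx2 p : p.1 ∈ k -> p.2 ∈ k -> p.2 `<=` mx p.
  rewrite /mx; case: pselect => [_ _ _|h p1 p2]; first exact: subset_refl.
  by have [] := ordinal_total (ordk _ p1) (ordk _ p2).
pose T := (idx k * idx k)%type.
pose val (t : T) := (elt t.1, elt t.2).
have v1 t : (val t).1 ∈ k by exists t.1.
have v2 t : (val t).2 ∈ k by exists t.2.
pose R (s t : T) := r (val s) (val t).
have wfR : well_founded R by exact: (wf_inverse_image _ _ _ _ wfr).
have Rt u v w : R u v -> R v w -> R u w.
  have tm : transitive_set (mx (val w)) by have [] := ordk _ (mxk _ (v1 w) (v2 w)).
  have t1 : transitive_set (val w).1 by have [] := ordk _ (v1 w).
  have t2 : transitive_set (val w).2 by have [] := ordk _ (v2 w).
  rewrite /R /r => -[h|[e h]] [h'|[e' h']].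
  - by left; exact: (tm _ h').
  - by left; rewrite -e'.
  - by left; rewrite e.
  right; rewrite e e'; split=> //; case: h h' => [h|[-> h]] [h'|[e2 h']].
  - by left; exact: (t1 _ h').
  - by left; rewrite -e2.
  - by left.
  - by right; split=> //; exact: (t2 _ h').
have [pi piE] := collapse wfR.
have piord := collapse_ordinal Rt piE.
have Rtri s t : [\/ R s t, val s = val t | R t s].
  have [] := ordinal_trichotomy (ordk _ (mxk _ (v1 s) (v2 s))) (ordk _ (mxk _ (v1 t) (v2 t))).
  - by constructor 1; left.
  - move=> e; have [] := ordinal_trichotomy (ordk _ (v1 s)) (ordk _ (v1 t)).
    + by constructor 1; right; split=> //; left.
    + move=> e1; have [] := ordinal_trichotomy (ordk _ (v2 s)) (ordk _ (v2 t)).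
      * by constructor 1; right; split=> //; right.
      * by move=> e2; constructor 2; move: e1 e2; rewrite /val /= => -> ->.
      * by constructor 3; right; split=> //; right.
    + by constructor 3; right; split=> //; left.
  - by constructor 3; left.
have /choice [ix ixP] : forall p : V * V, exists t : option T,
    p.1 ∈ k -> p.2 ∈ k -> exists2 s, t = Some s & val s = p.
  move=> [a b] /=; case: (pselect (a ∈ k /\ b ∈ k)) => [[[i ia] [j jb]]|n].
    by exists (Some (i, j)) => _ _; exists (i, j); rewrite // /val /= ia jb.
  by exists None => ak bk; case: n.
pose g p := if ix p is Some t then pi t else vempty.
have piI s t : pi s = pi t -> val s = val t.
  move=> e; have [h|//|h] := Rtri s t.
    have : pi s ∈ pi t by apply/piE; exists s.
    by rewrite e => /mem_irr.
  have : pi t ∈ pi s by apply/piE; exists t.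
  by rewrite e => /mem_irr.
have piV s t : val s = val t -> pi s = pi t.
  by move=> e; apply: V_ext; apply/seteqP; split=> x /piE[w Rw <-];
    apply/piE; exists w => //; move: Rw; rewrite /R e.
have gE t : g (val t) = pi t.
  by rewrite /g; have [s -> /piV] := ixP _ (v1 t) (v2 t).
apply: (@cle_fun _ _ _ _ g); last first.
  move=> p q [/= p1 p2] [/= q1 q2].
  have [s _ <-] := ixP _ p1 p2; have [t _ <-] := ixP _ q1 q2.
  by rewrite !gE => /piI.
move=> p [/= p1 p2]; have [t _ tp] := ixP _ p1 p2; rewrite -tp gE.
apply: contrapT => /(ordinal_notin ok (piord t)) /subset_card_le kle.
(* All predecessors of [val t] lie in the square of [vsucc m], which is finite or, by the induction
   hypothesis, smaller than [k]. Hence [k] cannot be included in [pi t]. *)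
pose m := mx (val t); have mk : m ∈ k by exact: mxk.
suff : members (pi t) #< k by case=> _; apply.
apply: (@cle_lt_trans _ _ _ _ (members (vsucc m) `*` members (vsucc m))).
  apply: (@cle_surj _ _ _ _ g) => x /piE[s Rs <-]; exists (val s); last by rewrite gE.
  have : mx (val s) ∈ m \/ mx (val s) = m by case: Rs => [|[]]; [left|right].
  have om : is_ordinal m by exact: ordk.
  have h a : a ∈ k -> a `<=` mx (val s) -> mx (val s) ∈ m \/ mx (val s) = m -> a ∈ vsucc m.
    move=> ak am sm; apply/mem_vsucc; apply: ordinal_sub => //; first exact: ordk.
    case: sm => [sm|<- //]; apply: (subset_trans am).
    by have [t' _ _ _] := om; exact: t'.
  by move=> sm; split; apply: h (v1 s) _ sm || apply: h (v2 s) _ sm; [exact: mx1|exact: mx2].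
have mS : members (vsucc m) = m |` m.
  by apply/seteqP; split=> z; [move=> /mem_vsucc[]; [right|left]|move=> [->|zm]; apply/mem_vsucc; [right|left]].
case: (pselect (finite_set m)) => [fm|im].
  apply: finite_clt => //; have fS : finite_set (vsucc m).
    by rewrite mS finite_setU; split=> //; exact: finite_set1.
  exact: finite_setX.
have [c [cm cc mc cmle]] := clt_cardinal ck (cardinal_clt ck mk).
have ic : infinite_set c by exact: infinite_cle mc.
have mSc : members (vsucc m) #<= c.
  by rewrite mS; apply: card_le_trans mc; exact: infinite_setU1.
apply: (cle_lt_trans (setX_cle mSc mSc)).
apply: (cle_lt_trans (IH _ cm cc ic)); exact: cardinal_clt.
Qed.

Lemma cle_sqr T (A : set T) (x : V) : A #<= x -> infinite_set A -> A `*` A #<= A.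
Proof.
move=> Ax iA; have [k [ck Ak kA]] := small_card Ax.
apply: (card_le_trans (setX_cle Ak Ak)); apply: card_le_trans kA.
apply: cardinal_sqr => //; exact: infinite_cle Ak.
Qed.

Lemma bigcup_clei J T (I : set J) (A : J -> set T) (k : V) : infinite_set k ->
  I #<= k -> (forall i, I i -> A i #<= k) -> \bigcup_(i in I) A i #<= k.
Proof.
move=> ik Ik Ak; apply: (card_le_trans (bigcup_cle Ik Ak)).
exact: (@cle_sqr _ _ k).
Qed.

(** The values of [h] are too few to be cofinal in [k]. Some [g] in [k] is therefore included in no
    [h i], and by comparability it contains them all. *)
Lemma regular_bound J (k : V) (I : set J) (h : J -> V) : is_regular k ->
  I #< k -> (forall i, I i -> h i ∈ k) ->
  exists2 g, g ∈ k & forall i, I i -> h i ∈ g.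
Proof.
move=> [[ok _] _ rk] Ik hk.
have /not_andP : ~ cofinal (fun a b : V => a `<=` b) (h @` I) k.
  move=> /rk; apply; exact: (cle_lt_trans (card_image_le _ _)).
case=> [[]|]; first by move=> _ [i /hk h1 <-].
move=> /existsNP[g /not_implyP[gk gh]]; exists g => // i Ii.
apply: contrapT => nhg; apply: gh; exists (h i); first by exists i.
by apply: ordinal_notin => //; apply: (mem_ordinal ok) => //; exact: hk.
Qed.

(** Regularity gives one [b] in [k] that bounds the index set and all the sizes. The union is then
    bounded by the square of [b], which is finite or no larger than [b]. *)
Lemma regular_bigcup J T (I : set J) (A : J -> set T) (k : V) : is_regular k ->
  I #< k -> (forall i, I i -> A i #< k) -> \bigcup_(i in I) A i #< k.
Proof.
move=> rk Ik Ak; have [ck ik _] := rk; have [ok _] := ck.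
have /choice [h hP] : forall i, exists a, I i -> a ∈ k /\ A i #<= a.
  move=> i; case: (pselect (I i)) => [/Ak/(clt_cardinal ck)[a [ak _ Aa _]]|n].
    by exists a.
  by exists vempty.
have [|g gk gP] := @regular_bound _ k I h rk Ik; first by move=> i /hP[].
have [a [ak _ Ia _]] := clt_cardinal ck Ik.
have [b bk [ab gb]] : exists2 b, b ∈ k & a `<=` b /\ g `<=` b.
  have [h1|h1] := ordinal_total (mem_ordinal ok ak) (mem_ordinal ok gk).
    by exists g; [|split; [exact: h1|exact: subset_refl]].
  by exists a; [|split; [exact: subset_refl|exact: h1]].
have Ib : I #<= b by apply: (card_le_trans Ia); exact: subset_card_le.
have Ab i : I i -> A i #<= b.
  move=> Ii; have [hk /card_le_trans] := hP _ Ii; apply; apply: subset_card_le.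
  apply: subset_trans gb; have [tg _ _ _] := mem_ordinal ok gk; apply: tg; exact: gP.
apply: (cle_lt_trans (bigcup_cle Ib Ab)).
case: (pselect (finite_set b)) => [fb|ib].
  by apply: finite_clt => //; exact: finite_setX.
apply: (cle_lt_trans (@cle_sqr _ _ b _ ib)) => //; exact: cardinal_clt.
Qed.

(** * Closure under finitary set-valued functions *)

Lemma members_vsucc (a : V) : members (vsucc a) = a |` a.
Proof.
by apply/seteqP; split=> z; [move=> /mem_vsucc[]; [right|left]|
  move=> [->|za]; apply/mem_vsucc; [right|left]].
Qed.

Lemma vsucc_clt (k a : V) : is_cardinal k -> infinite_set k -> a ∈ k ->
  members (vsucc a) #< k.
Proof.
move=> ck ik ak; rewrite members_vsucc; case: (pselect (finite_set a)) => [fa|ia].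
  by apply: finite_clt => //; rewrite finite_setU; split=> //; exact: finite_set1.
apply: (cle_lt_trans (infinite_setU1 _ ia)); exact: cardinal_clt.
Qed.

Lemma ordinal_vsucc (a : V) : is_ordinal a -> is_ordinal (vsucc a).
Proof.
move=> oa; have [ta _ _ _] := oa; apply: ordinal_of_transitive.
  by move=> x /mem_vsucc[xa|->] y yx; apply/mem_vsucc; left=> //; exact: (ta _ xa).
by move=> x /mem_vsucc[xa|-> //]; exact: (ordinal_transitive oa).
Qed.

Lemma vsucc_limit (k a : V) : is_cardinal k -> infinite_set k -> a ∈ k -> vsucc a ∈ k.
Proof.
move=> ck ik ak; have [ok _] := ck; apply: contrapT.
have oS : is_ordinal (vsucc a) by apply: ordinal_vsucc; exact: mem_ordinal ak.
move=> /(ordinal_notin ok oS)/subset_card_le kS.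
by have [_] := vsucc_clt ck ik ak.
Qed.

Lemma seq_directed J (T : eqType) (I : set J) (A : J -> set T) (s : seq T) : I !=set0 ->
  (forall i j, I i -> I j -> A i `<=` A j \/ A j `<=` A i) ->
  (forall x, x \in s -> exists2 i, I i & A i x) ->
  exists2 i, I i & forall x, x \in s -> A i x.
Proof.
move=> [i0 Ii0] tot; elim: s => [|x s IH] h; first by exists i0.
have [y ys|i Ii As] := IH; first by apply: h; rewrite in_cons ys orbT.
have [j Ij Ax] := h x (mem_head _ _).
have [ij|ji] := tot _ _ Ii Ij; [exists j|exists i] => // y;
  rewrite in_cons => /orP[/eqP->|/As] //; [exact: ij|exact: ji].
Qed.

Lemma fset_directed J (T : choiceType) (I : set J) (A : J -> set T) (s : {fset T}) :
  I !=set0 ->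
  (forall i j, I i -> I j -> A i `<=` A j \/ A j `<=` A i) ->
  [set` s] `<=` \bigcup_(i in I) A i ->
  exists2 i, I i & [set` s] `<=` A i.
Proof.
move=> I0 tot sA; have [x /sA//|i Ii h] := @seq_directed _ _ I A (enum_fset s) I0 tot.
by exists i.
Qed.

Definition fin_sub (T : choiceType) (A : set T) : set {fset T} :=
  [set s : {fset T} | [set` s] `<=` A].

Definition seq_of (T : eqType) (A : set T) : set (seq T) := [set s | forall x, x \in s -> A x].

Lemma seq_of_cle (T : eqType) (A : set T) (c : V) : infinite_set c -> A #<= c -> seq_of A #<= c.
Proof.
move=> ic Ac; pose L n := [set s | seq_of A s /\ size s = n].
have Ln n : L n #<= c.
  elim: n => [|n IH].
    apply: (@card_le_trans _ _ _ [set [::] : seq T]); first by apply: subset_card_le => -[|x s] [].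
    by have [] := finite_clt (finite_set1 ([::] : seq T)) ic.
  case: (pselect (L n.+1 = set0)) => [->|/eqP/set0P[s0 Ls0]]; first exact: card_ge0.
  have [x0 _] : exists x0 : T, True by case: s0 Ls0 => [[]//|x s _]; exists x.
  apply: (@card_le_trans _ _ _ (members c `*` members c)); last exact: (@cle_sqr _ _ c).
  apply: card_le_trans (setX_cle Ac IH).
  apply: (@cle_surj _ _ _ _ (fun z => z.1 :: z.2)) => -[|x s] [sA //= [ss]].
  exists (x, s) => //; split=> /=; first by apply: sA; exact: mem_head.
  by split=> // y ys; apply: sA; rewrite in_cons ys orbT.
apply: (@card_le_trans _ _ _ (\bigcup_(n in [set: nat]) L n)).
  by apply: subset_card_le => s sA; exists (size s).
by apply: bigcup_clei => //; apply/infiniteP.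
Qed.

Lemma fin_sub_cle (T : choiceType) (A : set T) (c : V) :
  infinite_set c -> A #<= c -> fin_sub A #<= c.
Proof.
move=> ic /(seq_of_cle ic); apply: card_le_trans.
apply: (@cle_surj _ _ _ _ (fun s => [fset x in s]%fset)) => s sA.
exists (enum_fset s); first by move=> x xs; exact: sA.
by apply/fsetP => x; rewrite !inE.
Qed.

(** The infinite [k] takes care of finite [A]: the larger of [k] and a bound for [A] is infinite,
    still below [l], and bounds the number of finite subsets. *)
Lemma regular_fin_sub (T : choiceType) (A : set T) (k l : V) : is_cardinal l ->
  infinite_set k -> k ∈ l -> A #< l -> fin_sub A #< l.
Proof.
move=> cal ik kl Al; have [ol _] := cal; have [a [al _ Aa _]] := clt_cardinal cal Al.
have [h|h] := ordinal_total (mem_ordinal ol al) (mem_ordinal ol kl).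
  apply: (cle_lt_trans (fin_sub_cle ik (card_le_trans Aa (subset_card_le h)))).
  exact: cardinal_clt.
have ia : infinite_set a by apply: infinite_cle ik _; exact: subset_card_le.
apply: (cle_lt_trans (fin_sub_cle ia Aa)); exact: cardinal_clt.
Qed.

Section Closure.
Variables (T : choiceType) (F : {fset T} -> set T).

Definition fin_closed (N : set T) := forall s : {fset T}, [set` s] `<=` N -> F s `<=` N.

Fixpoint stage (Y : set T) n : set T :=
  if n is m.+1 then stage Y m `|` \bigcup_(s in fin_sub (stage Y m)) F s else Y.

Definition fin_closure (Y : set T) := \bigcup_(n in [set: nat]) stage Y n.

Lemma sub_fin_closure Y : Y `<=` fin_closure Y. Proof. by move=> x Yx; exists 0%N. Qed.

Lemma stage_le Y m n : (m <= n)%N -> stage Y m `<=` stage Y n.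
Proof.
elim: n => [|n IH]; first by rewrite leqn0 => /eqP ->; exact: subset_refl.
by rewrite leq_eqVlt => /orP[/eqP->|/IH h x /h]; [exact: subset_refl|left].
Qed.

Lemma fin_closed_bigcup J (I : set J) (A : J -> set T) : I !=set0 ->
  (forall i j, I i -> I j -> A i `<=` A j \/ A j `<=` A i) ->
  (forall i, I i -> fin_closed (A i)) -> fin_closed (\bigcup_(i in I) A i).
Proof.
move=> I0 tot Acl s /(fset_directed I0 tot)[i Ii /(Acl _ Ii) h] x /h.
by exists i.
Qed.

Lemma fin_closure_closed Y : fin_closed (fin_closure Y).
Proof.
move=> s /fset_directed[|m n _ _|n _ sn x Fx]; first by exists 0%N.
  by case/orP: (leq_total m n) => /(stage_le (Y := Y)); [left|right].
by exists n.+1 => //; right; exists s.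
Qed.

Lemma fin_closure_min Y N : Y `<=` N -> fin_closed N -> fin_closure Y `<=` N.
Proof.
move=> YN Ncl x [n _]; elim: n x => [|n IH] x; first exact: YN.
by case=> [/IH//|[s sn Fx]]; apply: (Ncl s) Fx => y /sn /IH.
Qed.

Lemma fin_closure_mono Y Z : Y `<=` Z -> fin_closure Y `<=` fin_closure Z.
Proof. by move=> YZ; apply: fin_closure_min (@fin_closure_closed Z) => x /YZ; exact: sub_fin_closure. Qed.

Lemma fin_closure_cle (Y : set T) (c : V) : infinite_set c -> Y #<= c ->
  (forall s, F s #<= c) -> fin_closure Y #<= c.
Proof.
move=> ic Yc Fc; apply: bigcup_clei => // [|n _]; first exact/infiniteP.
elim: n => [|n IH] //=.
apply: (@card_le_trans _ _ _ (\bigcup_(b in [set: bool])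
    if b then stage Y n else \bigcup_(s in fin_sub (stage Y n)) F s)).
  by apply: subset_card_le => x [h|h]; [exists true|exists false].
apply: bigcup_clei => // [|[] _ //].
  by have [] := finite_clt (@finite_finset _ [set: bool]) ic.
by apply: bigcup_clei => //; exact: fin_sub_cle.
Qed.

(** The infinite [k] in [l] makes [l] uncountable, so regularity applies to the union of the
    countably many stages. *)
Lemma fin_closure_clt (Y : set T) (k l : V) : is_regular l -> infinite_set k -> k ∈ l ->
  Y #< l -> (forall s, F s #< l) -> fin_closure Y #< l.
Proof.
move=> rl ik kl Yl Fl; have [cal _ _] := rl.
have kl' := cardinal_clt cal kl.
apply: regular_bigcup => // [|n _].
  by apply: cle_lt_trans kl'; exact/infiniteP.
elim: n => [|n IH] //=.
apply: (@cle_lt_trans _ _ _ _ (\bigcup_(b in [set: bool])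
    if b then stage Y n else \bigcup_(s in fin_sub (stage Y n)) F s)).
  by apply: subset_card_le => x [h|h]; [exists true|exists false].
have il : infinite_set l by have [] := rl.
apply: regular_bigcup => // [|[] _ //].
  by apply: finite_clt => //; exact: finite_finset.
by apply: regular_bigcup => //; exact: (regular_fin_sub cal ik kl).
Qed.

End Closure.

(** * From closed sets to the Freese-Nation property *)

(** Split off so that one argument about cofinal sets serves both the order and its reverse. *)
Definition half_le (k : V) T (le : T -> T -> Prop) (A P : set T) : Prop :=
  forall p, P p -> exists2 C, cofinal le C (A `&` [set a | le a p]) & C #< k.

Lemma le_kappaE k T (le : T -> T -> Prop) (A P : set T) :
  le_kappa k le A P <-> half_le k le A P /\ half_le k (fun x y => le y x) A P.
Proof.
split=> [h|[h1 h2] p Pp]; last by split; [exact: h1|exact: h2].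
by split=> p Pp; have [] := h p Pp.
Qed.

Lemma regular_setU T (A B : set T) (k : V) : is_regular k -> A #< k -> B #< k ->
  A `|` B #< k.
Proof.
move=> rk Ak Bk; have [_ ik _] := rk.
apply: (@cle_lt_trans _ _ _ _ (\bigcup_(b in [set: bool]) if b then A else B)).
  by apply: subset_card_le => x [h|h]; [exists true|exists false].
apply: regular_bigcup => // [|[] //]; apply: finite_clt => //; exact: finite_finset.
Qed.

Lemma le_kappa0 k T (le : T -> T -> Prop) (P : set T) : is_regular k ->
  le_kappa k le set0 P.
Proof.
move=> [_ ik _] p Pp; split; exists set0; (try by apply: finite_clt);
by split=> [x|x []].
Qed.

Section Freese_Nation.
Variables (kappa lambda : V) (P : set V) (le : V -> V -> Prop).
Hypotheses (rkappa : is_regular kappa) (rlambda : is_regular lambda)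
  (hlt : kappa ∈ lambda) (poP : is_partial_order P le).

Let ck : is_cardinal kappa. Proof. by case: rkappa. Qed.
Let cla : is_cardinal lambda. Proof. by case: rlambda. Qed.
Let ik : infinite_set kappa. Proof. by case: rkappa. Qed.
Let il : infinite_set lambda. Proof. by case: rlambda. Qed.
Let kl : members kappa #< lambda. Proof. exact: cardinal_clt. Qed.

(** With fewer than [lambda] elements, [f] may be constantly [A], and [g p] only has to contain
    [p]. *)
Lemma has_FN_small (A : set V) : A `<=` P -> A #< lambda -> has_FN lambda kappa A le.
Proof.
move=> AP Al; have [_ rle _ _] := poP; exists (fun=> A), (fun p => [set p]); split=> [p Ap|p q Ap Aq pq].
  split; first by split=> //; exact: subset_refl.
  by split=> [x -> //|]; apply: finite_clt => //; exact: finite_set1.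
split; first by exists q; split=> //; apply: rle; exact: AP.
by exists p; split=> //; apply: rle; exact: AP.
Qed.

(** Gluing along a filtration: an element [p] that first appears at stage [lev p]
    is approximated from the earlier stages by the small sets of [le_kappa], and
    [reach] collects everything obtained by iterating this. *)
Section Glue.
Variables (k : V) (N : V -> set V) (lev : V -> V) (A : set V).
Hypotheses (ok : is_ordinal k) (AP : A `<=` P).
Hypotheses (levk : forall p, A p -> lev p ∈ k) (levN : forall p, A p -> N (lev p) p)
  (levmin : forall p b, A p -> N b p -> ~ b ∈ lev p)
  (NA : forall b, b ∈ k -> N b `<=` A)
  (NFN : forall b, b ∈ k -> has_FN lambda kappa (N b) le)
  (Nle : forall a, a ∈ k -> le_kappa kappa le (\bigcup_(b in members a) N b) P).

Lemma glue_FN : has_FN lambda kappa A le.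
Proof.
have [leP lerefl _ letr] := poP.
have /choice [fg fgP] : forall b, exists fg : (V -> set V) * (V -> set V), b ∈ k ->
    (forall p, N b p -> subsets_lt (N b) lambda (fg.1 p) /\ subsets_lt (N b) kappa (fg.2 p)) /\
    (forall p q, N b p -> N b q -> le p q ->
      (exists r, [/\ fg.1 p r, fg.2 q r, le p r & le r q]) /\
      (exists s, [/\ fg.2 p s, fg.1 q s, le p s & le s q])).
  move=> b; case: (pselect (b ∈ k)) => [/NFN[f [g h]]|n]; first by exists (f, g).
  by exists (fun=> set0, fun=> set0).
pose low p := \bigcup_(b in members (lev p)) N b.
have /choice [CD CDP] : forall p, exists CD : set V * set V, A p ->
    [/\ cofinal le CD.1 (low p `&` [set a | le a p]), CD.1 #< kappa,
        coinitial le CD.2 (low p `&` [set a | le p a]) & CD.2 #< kappa].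
  move=> p; case: (pselect (A p)) => [Ap|n]; last by exists (set0, set0).
  have [[C h1 h2] [D h3 h4]] := Nle (levk Ap) (AP Ap).
  by exists (C, D).
(* [S p c] means that [c] is one of the chosen approximations of [p] from earlier stages; by [SP]
   the level drops along [S]. *)
pose S p c := A p /\ ((CD p).1 c \/ (CD p).2 c).
have SP p c : S p c -> A c /\ lev c ∈ lev p.
  move=> [Ap Cc]; have [[Cl _] _ [Dl _] _] := CDP _ Ap.
  have [b bp Nb] : low p c by case: Cc => [/Cl[]|/Dl[]].
  have bk : b ∈ k by have [tk _ _ _] := ok; apply: (tk _ (levk Ap)).
  have Ac : A c by exact: (NA bk).
  split=> //; have := levmin Ac Nb => nb.
  have obl := mem_ordinal ok bk; have olc := mem_ordinal ok (levk Ac).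
  have := ordinal_notin olc obl nb.
  move=> /(ordinal_sub olc obl)[h|-> //].
  have [tl _ _ _] := mem_ordinal ok (levk Ap); exact: (tl _ bp).
pose reach := clos_refl_trans_1n V S.
pose G (g0 : V -> set V) p : set V := [set r | exists2 c, reach p c & g0 c r].
have Gtr g0 p c : S p c -> G g0 c `<=` G g0 p.
  by move=> pc r [d cd dr]; exists d => //; apply: rt1n_trans cd.
have Gself g0 p : g0 p `<=` G g0 p by move=> r gr; exists p => //; exact: rt1n_refl.
(* Each [p] has fewer than [kappa] successors under [S], all of lower level, so induction on the
   level keeps [G g0 p] smaller than [l]. The case [l = lambda] is for [f], the case [l = kappa] for
   [g]. *)
have Gsub (l : V) g0 : is_regular l -> kappa `<=` l ->
    (forall c, A c -> subsets_lt (N (lev c)) l (g0 c)) ->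
    forall p, A p -> subsets_lt A l (G g0 p).
  move=> rl kll g0P; have kappal : members kappa #<= l by exact: subset_card_le.
  suff h m : forall p, lev p = m -> A p -> subsets_lt A l (G g0 p).
    by move=> p; apply: h.
  elim/(well_founded_ind mem_wf): m => m IH p pm Ap.
  have GE : G g0 p `<=` g0 p `|` \bigcup_(c in S p) G g0 c.
    move=> r [c pc cr]; case: pc cr => [gr|c' d pc' c'd dr]; first by left.
    by right; exists c' => //; exists d.
  have IHS c : S p c -> subsets_lt A l (G g0 c).
    by move=> /SP[Ac]; rewrite pm => cm; exact: (IH _ cm).
  have [g0N g0l] := g0P _ Ap; split.
    move=> r /GE[/g0N/(NA (levk Ap)) //|[c pc cr]].
    by have [h _] := IHS _ pc; exact: h.
  apply: (cle_lt_trans (subset_card_le GE)); apply: regular_setU => //.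
  apply: regular_bigcup => //; last by move=> c /IHS[].
  have [_ Ck _ Dk] := CDP _ Ap.
  apply: (@cle_lt_trans _ _ _ _ ((CD p).1 `|` (CD p).2)).
    by apply: subset_card_le => c [].
  by apply: regular_setU => //; apply: (clt_le_trans _ kappal).
pose f p := G (fun c => (fg (lev c)).1 c) p; pose g p := G (fun c => (fg (lev c)).2 c) p.
exists f, g; split=> [p Ap|].
  split; apply: Gsub => //.
  - by have [ol _] := cla; have [tl _ _ _] := ol; exact: tl.
  - by move=> c Ac; have [h _] := fgP _ (levk Ac); have [] := h c (levN Ac).
  - by move=> c Ac; have [h _] := fgP _ (levk Ac); have [] := h c (levN Ac).
(* Induction on a strict bound [m] of both levels. At equal levels the map of that stage
   interpolates. Otherwise the element of higher level is replaced by one of its approximations [c]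
   lying between [p] and [q], and its level becomes the new bound; interpolants found for [c] are
   reachable from the replaced element too. *)
suff h m : is_ordinal m -> forall p q, A p -> A q -> lev p ∈ m -> lev q ∈ m -> le p q ->
    (exists r, [/\ f p r, g q r, le p r & le r q]) /\
    (exists s, [/\ g p s, f q s, le p s & le s q]).
  by move=> p q Ap Aq; apply: (h k) => //; exact: levk.
elim/(well_founded_ind mem_wf): m => m IH om p q Ap Aq pm qm pq.
have olp := mem_ordinal ok (levk Ap); have olq := mem_ordinal ok (levk Aq).
have [pq'|e|qp] := ordinal_trichotomy olp olq.
- have [[Csub Ccof] _ _ _] := CDP _ Aq.
  have [|c Cc pc] := Ccof p; first by split=> //; exists (lev p) => //; exact: levN.
  have [_ /= cq] := Csub _ Cc; have Sqc : S q c by split=> //; left.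
  have [Ac levc] := SP _ _ Sqc.
  have [[r [r1 r2 r3 r4]] [s [s1 s2 s3 s4]]] := IH _ qm olq p c Ap Ac pq' levc pc.
  split; [exists r|exists s]; split=> //; try exact: (Gtr _ _ _ Sqc).
  + exact: letr cq.
  + exact: letr cq.
- have [_ h] := fgP _ (levk Aq); have Np : N (lev q) p by rewrite -e; exact: levN.
  have [[r [r1 r2 r3 r4]] [s [s1 s2 s3 s4]]] := h p q Np (levN Aq) pq.
  by split; [exists r|exists s]; split=> //; apply: Gself; rewrite ?e.
- have [_ _ [Dsub Dcof] _] := CDP _ Ap.
  have [|c Dc cq] := Dcof q; first by split=> //; exists (lev q) => //; exact: levN.
  have [_ /= pc] := Dsub _ Dc; have Spc : S p c by split=> //; right.
  have [Ac levc] := SP _ _ Spc.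
  have [[r [r1 r2 r3 r4]] [s [s1 s2 s3 s4]]] := IH _ pm olp c q Ac Aq levc qp cq.
  split; [exists r|exists s]; split=> //; try exact: (Gtr _ _ _ Spc).
  + exact: letr r3.
  + exact: letr s3.
Qed.

End Glue.

(** Induction on the size of closed sets, with [has_FN_small] below [lambda] and [glue_FN] from
    there on. As [P] is a class in this section, [c] expresses that it has the size of a set. *)
Lemma has_FN_of_fin_closed (F : {fset V} -> set V) :
  (forall s, F s #< lambda) ->
  (forall N, fin_closed F N -> le_kappa kappa le (P `&` N) P) ->
  (exists c : V, P #<= c) -> has_FN lambda kappa P le.
Proof.
move=> Fl Fle [c Pc].
have claF Y : Y #< lambda -> fin_closure F Y #< lambda.
  by move=> Yl; exact: (fin_closure_clt rlambda ik hlt).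
suff main k : is_cardinal k -> forall N, fin_closed F N -> N #<= k ->
    has_FN lambda kappa (P `&` N) le.
  suff [k ck' Pk] : exists2 k, is_cardinal k & fin_closure F P #<= k.
    rewrite (_ : P = P `&` fin_closure F P); first by apply: (main k) => //; exact: fin_closure_closed.
    by apply/seteqP; split=> [x Px|x []//]; split=> //; exact: sub_fin_closure.
  have [lP|Pl] := cle_clt_total lambda P.
    have [k [ck' Pk kP]] := small_card Pc; exists k => //.
    have ik' : infinite_set k by apply: infinite_cle (card_le_trans lP Pk).
    apply: fin_closure_cle => // s; apply: card_le_trans (card_le_trans lP Pk).
    by have [] := Fl s.
  by exists lambda => //; have [] := claF _ Pl.
elim/(well_founded_ind mem_wf): k => k IH ck' N Ncl Nk.
have [lN|Nl] := cle_clt_total lambda N; last first.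
  by apply: has_FN_small; [move=> x []|apply: cle_lt_trans Nl; apply: subset_card_le => x []].
have lk : lambda #<= k by exact: card_le_trans Nk.
have ik' : infinite_set k by exact: infinite_cle lk.
have [ok _] := ck'; have [tk _ _ _] := ok.
have [x0 Nx0] : N !=set0 by apply: infinite_setN0; exact: infinite_cle lN.
have [b [bN bs]] := cle_onto Nx0 Nk.
(* [N] is enumerated by [b] along [k]. Using [vsucc a] puts [b a] itself into [Na a], so every
   element of [N] occurs at some stage. *)
pose Na a := fin_closure F (b @` vsucc a).
have Nacl a : fin_closed F (Na a) by exact: fin_closure_closed.
have Nmono a a' : a' ∈ k -> a ∈ a' -> Na a `<=` Na a'.
  move=> ak aa; apply: fin_closure_mono => _ [x /mem_vsucc xa <-]; exists x => //.
  apply/mem_vsucc; left; have [t _ _ _] := mem_ordinal ok ak.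
  by case: xa => [xa|-> //]; exact: (t _ aa).
have NaN a : Na a `<=` N by apply: fin_closure_min => // _ [x _ <-].
have Nalt a : a ∈ k -> Na a #< k.
  move=> ak; have Yk : b @` vsucc a #< k.
    apply: (cle_lt_trans (card_image_le _ _)); exact: vsucc_clt.
  (* A generating set smaller than [lambda] has a closure smaller than [lambda]. A larger one has a
     closure no larger than itself, since the values of [F] have size below [lambda]. *)
  have [lY|Yl] := cle_clt_total lambda (b @` vsucc a); last first.
    by apply: clt_le_trans lk; exact: claF.
  have [d [dk cd Yd dY]] := clt_cardinal ck' Yk.
  have ld := card_le_trans lY Yd.
  apply: (@cle_lt_trans _ _ _ _ (members d)); last exact: cardinal_clt.
  apply: fin_closure_cle => //; first exact: infinite_cle ld.
  by move=> s; apply: card_le_trans ld; have [] := Fl s.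
have tot a a' : a ∈ k -> a' ∈ k -> Na a `<=` Na a' \/ Na a' `<=` Na a.
  move=> ak ak'; have [h|->|h] := ordinal_trichotomy (mem_ordinal ok ak) (mem_ordinal ok ak').
  - by left; exact: Nmono.
  - by left; exact: subset_refl.
  - by right; exact: Nmono.
have /choice [lev levP] : forall x, exists a, (P `&` N) x ->
    [/\ a ∈ k, Na a x & forall a', Na a' x -> ~ a' ∈ a].
  move=> x; case: (pselect ((P `&` N) x)) => [[_ Nx]|n]; last by exists x0.
  have [|a [ak Nax] amin] := @mem_min [set a | a ∈ k /\ Na a x].
    have [a ak ax] := bs _ Nx; exists a; split=> //; apply: sub_fin_closure.
    by exists a => //; apply/mem_vsucc; right.
  exists a => _; split=> // a' Na' aa; apply: (amin _ aa); split=> //.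
  exact: (tk _ ak).
apply: (@glue_FN k (fun a => P `&` Na a) lev) => //.
- by move=> x /levP[].
- by move=> x h; have [] := levP _ h; split=> //; case: h.
- by move=> x a h [_]; have [_ _] := levP _ h; apply.
- by move=> a _ x [Px /NaN].
- move=> a ak; have [d [dk cd Yd _]] := clt_cardinal ck' (Nalt _ ak).
  exact: (IH _ dk).
(* The empty union is treated apart: [F] may have a nonempty value at the empty set, and then the
   empty set is not closed. *)
move=> a ak; case: (pselect (members a = set0)) => [->|/eqP/set0P a0].
  by rewrite bigcup_set0; exact: le_kappa0.
rewrite -setI_bigcupr; apply: Fle; apply: fin_closed_bigcup => // i j ia ja.
by apply: tot; exact: (tk _ ak).
Qed.

(** * Closure functions from cofinal families closed under short chains *)

Section Kueker.
Variables (X : set V) (MM : set (set V)).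
Hypotheses (PX : P `<=` X) (MX : forall N, MM N -> N `<=` X)
  (Ml : forall N, MM N -> N #< lambda)
  (Mcof : forall Y, Y `<=` X -> Y #< lambda -> exists2 N, MM N & Y `<=` N)
  (Mchain : forall (d : V) (A : V -> set V), d ∈ lambda -> d #<= kappa -> d !=set0 ->
        (forall a, a ∈ d -> MM (A a)) ->
        (forall a b, a ∈ d -> b ∈ d -> a ∈ b -> A a `<=` A b) ->
        MM (\bigcup_(a in d) A a)).

(** Monotonicity is built in by recursion: [Fn n.+1 s] is a member of the family that includes
    [Fn n t] for every subset [t] of [s]. [F s] takes the cardinality of [s] as [n], so that a
    proper subset is served at an earlier step. *)
Lemma fin_hull : exists F : {fset V} -> set V, [/\ forall s, F s `<=` X,
  forall s, [set` s] `<=` X -> MM (F s) /\ [set` s] `<=` F s,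
  forall s, F s #< lambda &
  forall s t : {fset V}, [set` s] `<=` [set` t] -> [set` t] `<=` X -> F s `<=` F t].
Proof.
have /choice [up upP] : forall Y : set V, exists N, Y `<=` X -> Y #< lambda ->
    MM N /\ Y `<=` N.
  move=> Y; case: (pselect (Y `<=` X /\ Y #< lambda)) => [[YX Yl]|n].
    by have [N MN YN] := Mcof YX Yl; exists N.
  by exists set0 => YX Yl; case: n.
pose B (H : {fset V} -> set V) (s : {fset V}) : set V :=
  [set` s] `|` \bigcup_(t in [set` fpowerset s]) H t.
pose Fn := fix Fn n s := if n is m.+1 then up (B (Fn m) s) else up [set` s].
have sl (s : {fset V}) : [set` s] #< lambda by exact: finite_clt (finite_fset s) il.
have BX n s : (forall t : {fset V}, [set` t] `<=` X -> MM (Fn n t) /\ [set` t] `<=` Fn n t) ->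
    [set` s] `<=` X -> B (Fn n) s `<=` X /\ B (Fn n) s #< lambda.
  move=> IH sX; have tX t : t \in fpowerset s -> [set` t] `<=` X.
    by rewrite fpowersetE => /fsubsetP ts x /ts/sX.
  split; first by move=> x [/sX//|[t /= /tX/IH[/MX h _] /h]].
  apply: regular_setU => //; apply: regular_bigcup => //.
    by apply: finite_clt => //; exact: finite_fset.
  by move=> t /= /tX/IH[/Ml].
have FnP n : forall s : {fset V}, [set` s] `<=` X -> MM (Fn n s) /\ [set` s] `<=` Fn n s.
  elim: n => [|n IH] s sX; first exact: upP.
  have [BsX Bsl] := BX _ _ IH sX; have [MU BU] := upP _ BsX Bsl.
  by split=> // x xs; apply: BU; left.
have FnS n (s u : {fset V}) : [set` s] `<=` X -> (u `<=` s)%fset ->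
    Fn n u `<=` Fn n.+1 s.
  move=> sX us; have [BsX Bsl] := BX _ _ (FnP n) sX.
  have [_ BU] := upP _ BsX Bsl; apply: subset_trans BU => x ux.
  by right; exists u => //=; rewrite fpowersetE.
have Fnlt m n (s t : {fset V}) : (m < n)%N -> (s `<=` t)%fset -> [set` t] `<=` X ->
    Fn m s `<=` Fn n t.
  elim: n => // n IH; rewrite ltnS leq_eqVlt => /orP[/eqP->|mn] st tX.
    by exact: FnS.
  by apply: (subset_trans (IH mn st tX)); exact: FnS.
(* A finite set not included in [X] has no hull in the family; the empty value imposes no closure
   condition for it. *)
pose F (s : {fset V}) := if pselect ([set` s] `<=` X) is left _ then Fn #|` s| s else set0.
have FE (s : {fset V}) : [set` s] `<=` X -> F s = Fn #|` s| s by rewrite /F; case: pselect.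
have F0 (s : {fset V}) : ~ ([set` s] `<=` X) -> F s = set0 by rewrite /F; case: pselect.
exists F; split.
- move=> s; case: (pselect ([set` s] `<=` X)) => [sX|/F0->//].
  by rewrite FE//; apply: MX; have [] := FnP #|` s| _ sX.
- by move=> s sX; rewrite FE//; exact: FnP.
- move=> s; case: (pselect ([set` s] `<=` X)) => [sX|/F0->].
    by rewrite FE//; apply: Ml; have [] := FnP #|` s| _ sX.
  by apply: finite_clt.
move=> s t st tX; have sX : [set` s] `<=` X by exact: subset_trans tX.
have {}st : (s `<=` t)%fset by apply/fsubsetP => x /st.
rewrite !FE//; case: (eqVneq s t) => [-> //|ne].
by apply: Fnlt => //; apply: fproper_ltn_card; rewrite fproperEneq ne.
Qed.

Lemma Kueker : (forall N, MM N -> le_kappa kappa le (P `&` N) P) ->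
  exists F : {fset V} -> set V, (forall s, F s #< lambda) /\
    forall N, fin_closed F N -> le_kappa kappa le (P `&` N) P.
Proof.
move=> MP; have [F [FX FM Fl Fmono]] := fin_hull; exists F; split=> //.
pose G (Y : set V) := \bigcup_(s in fin_sub Y) F s.
have Gmono Y Z : Y `<=` Z -> G Y `<=` G Z.
  by move=> YZ x [s sY Fx]; exists s => //; exact: subset_trans YZ.
have [okl _] := cla; have [tl _ _ _] := okl.
have [oka _] := ck; have [tka _ _ _] := oka.
have tot (b : V -> V) (k : V) : is_ordinal k -> forall i j, i ∈ k -> j ∈ k ->
    b @` vsucc i `<=` b @` vsucc j \/ b @` vsucc j `<=` b @` vsucc i.
  move=> ok.
  have h i j : j ∈ k -> i ∈ j -> b @` vsucc i `<=` b @` vsucc j.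
    move=> jk ij _ [x /mem_vsucc xi <-]; exists x => //; apply/mem_vsucc; left.
    by have [t _ _ _] := mem_ordinal ok jk; case: xi => [xi|-> //]; exact: (t _ ij).
  move=> i j ik' jk; have [ij|->|ji] := ordinal_trichotomy (mem_ordinal ok ik') (mem_ordinal ok jk).
  - by left; exact: h.
  - by left; exact: subset_refl.
  - by right; exact: h.
have Gchain (b : V -> V) (k : V) : is_ordinal k -> k !=set0 ->
    G (b @` k) `<=` \bigcup_(a in members k) G (b @` vsucc a).
  move=> ok k0 x [s sb Fx].
  have [|a ak sa] := fset_directed k0 (tot b k ok) (s := s); last by exists a => //; exists s.
  by move=> y /sb[a ak <-]; exists a => //; exists a => //; apply/mem_vsucc; right.
(* Induction on the size of [Y]. If [Y] is finite, monotonicity makes its hull a single value of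
   [F]. Otherwise [Y] is enumerated along [k], and its hull is the union of the increasing hulls of
   smaller initial segments. Sizes stop at [kappa] because [Mchain] speaks of chains of at most that
   length. *)
have GM k : is_cardinal k -> k ∈ lambda -> k #<= kappa ->
    forall Y, Y `<=` X -> Y #<= k -> MM (G Y).
  elim/(well_founded_ind mem_wf): k => k IH ck' kl' kk Y YX Yk.
  case: (pselect (finite_set Y)) => [/finite_fsetP[s Ys]|iY].
    rewrite (_ : G Y = F s); first by have [] := FM s; rewrite -?Ys.
    apply/seteqP; split=> [x [t tY]|x Fx]; last by exists s => //; rewrite /fin_sub /= Ys.
    by apply: Fmono; rewrite -Ys.
  have ik' : infinite_set k by exact: infinite_cle Yk.
  have [ok _] := ck'; have [tk _ _ _] := ok.
  have k0 : members k !=set0 by exact: infinite_setN0.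
  have [y0 Yy0] : Y !=set0 by exact: infinite_setN0.
  have [b [bY bs]] := cle_onto Yy0 Yk.
  have bYE : Y = b @` k.
    by apply/seteqP; split=> [y /bs[a ak <-]|_ [a _ <-]//]; exists a.
  rewrite (_ : G Y = \bigcup_(a in members k) G (b @` vsucc a)); last first.
    apply/seteqP; split; first by rewrite bYE; exact: Gchain.
    by move=> x [a ak]; apply: Gmono => _ [z _ <-].
  apply: Mchain => //.
    move=> a ak; have : b @` vsucc a #< k.
      apply: (cle_lt_trans (card_image_le _ _)); exact: vsucc_clt.
    move=> /(clt_cardinal ck')[d [dk cd bd _]]; apply: (IH d) => //.
    - exact: (tl _ kl').
    - by apply: card_le_trans kk; apply: subset_card_le; exact: tk.
    - by move=> _ [z _ <-]; exact: YX.
  move=> a a' ak ak' aa; apply: Gmono => _ [x /mem_vsucc xa <-]; exists x => //.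
  apply/mem_vsucc; left; have [t _ _ _] := mem_ordinal ok ak'.
  by case: xa => [xa|-> //]; exact: (t _ aa).
(* Only transitivity of the order is used, so the claim applies to [le] and to its reverse. *)
suff half (le' : V -> V -> Prop) : (forall x y z, le' x y -> le' y z -> le' x z) ->
    (forall N, MM N -> half_le kappa le' (P `&` N) P) ->
    forall N, fin_closed F N -> half_le kappa le' (P `&` N) P.
  have [_ _ _ letr] := poP => N Ncl; apply/le_kappaE; split; apply: half => //.
  - by move=> M /MP/le_kappaE[].
  - by move=> x y z xy yz; exact: letr xy.
  - by move=> M /MP/le_kappaE[].
move=> letr MP' N Ncl p Pp; apply: contrapT => bad.
(* Each term [a i] of the sequence witnesses that the hull of the earlier terms is not cofinal in
   the part of [P ∩ N] below [p]. The default [vempty] of [xget] would be taken only if no witness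
   existed, which [aP] excludes. *)
pose bnd (Y : set V) x := [/\ P x, N x, le' x p &
  forall c, P c -> G Y c -> le' c p -> ~ le' x c].
pose step i (rec : forall j, j ∈ i -> V) := xget vempty (bnd [set y | exists j (h : j ∈ i), rec j h = y]).
pose a := Fix mem_wf (fun=> V) step.
have aE i : a i = xget vempty (bnd (a @` i)).
  rewrite /a Fix_eq; last first.
    move=> u f g fg; rewrite /step; congr (xget _ (bnd _)).
    by apply/seteqP; split=> y [j [h <-]]; exists j, h; rewrite fg.
  rewrite /step; congr (xget _ (bnd _)).
  by apply/seteqP; split=> y [j]; [case=> h <-; exists j|move=> h <-; exists j, h].
have aYk (Y : set V) i : i `<=` kappa -> Y = a @` i -> (Y `<=` P `&` N) ->
    half_le kappa le' (P `&` G Y) P /\ G Y `<=` N.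
  move=> ik' -> YN; split.
    apply: MP'; apply: (GM kappa) => //; first by move=> y /YN[/PX].
    by apply: (card_le_trans (card_image_le _ _)); exact: subset_card_le.
  by move=> x [s sY]; apply: Ncl => y /sY/YN[].
have aP i : i ∈ kappa -> bnd (a @` i) (a i).
  elim/(well_founded_ind mem_wf): i => i IH ik'.
  have ik2 : i `<=` kappa by exact: tka.
  have YN : a @` i `<=` P `&` N by move=> _ [j ji <-]; have [] := IH _ ji (ik2 _ ji).
  have [/(_ p Pp)[C [Csub Ccof] Ck] GN] := aYk _ _ ik2 erefl YN.
  (* Without a witness, the small set [C] that is cofinal for the hull would be cofinal for all of
     [N], against [bad]. *)
  rewrite aE; apply: xgetPex; apply: contrapT => /forallNP nx; apply: bad; exists C => //.
  split; first by move=> c /Csub[[Pc /GN Nc] cp].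
  move=> x [[Px Nx] /= xp]; apply: contrapT => nC; apply: (nx x); split=> // c Pc Gc cp xc.
  have [//|c' Cc' cc'] := Ccof c; apply: nC; exists c' => //; exact: letr cc'.
have YN : a @` kappa `<=` P `&` N by move=> _ [j jk <-]; have [] := aP _ jk.
have [/(_ p Pp)[C [Csub Ccof] Ck] GN] := aYk _ _ (@subset_refl _ _) erefl YN.
have k0 : members kappa !=set0 by exact: infinite_setN0.
(* [C] is cofinal for the hull of the whole sequence and smaller than [kappa]. By regularity it lies
   in the hull of the terms before some [g], yet [a g] is below one of its elements, against the
   choice of [a g]. *)
have /choice [h hP] : forall c, exists i, C c -> i ∈ kappa /\ G (a @` i) c.
  move=> c; case: (pselect (C c)) => [/Csub[[_ Gc] _]|n]; last by exists vempty.
  have [i ik' Gi] := Gchain a kappa oka k0 c Gc.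
  by exists (vsucc i) => _; split=> //; exact: vsucc_limit.
have [|g gk gP] := regular_bound rkappa Ck (h := h); first by move=> c /hP[].
have [Px Nx xp nx] := aP _ gk.
have [|c Cc xc] := Ccof (a g).
  split=> //; split=> //; exists [fset a g]%fset.
    by move=> y /=; rewrite inE => /eqP->; exists g.
  have [|_] := FM [fset a g]%fset; first by move=> y /=; rewrite inE => /eqP->; exact: PX.
  by apply; rewrite /= inE.
have [[Pc _] cp] := Csub _ Cc; have [hk Gc] := hP _ Cc.
apply: (nx c Pc _ cp xc); apply: Gmono Gc => _ [j jh <-]; exists j => //.
have [t _ _ _] := mem_ordinal oka gk; exact: (t _ (gP _ Cc)).
Qed.

End Kueker.
End Freese_Nation.

(** * Clubs and the Freese-Nation property *)

Lemma club_has_FN (kappa lambda P : V) (le : V -> V -> Prop) :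
  is_regular kappa -> is_regular lambda -> kappa ∈ lambda -> is_partial_order P le ->
  (exists2 E : set (set V), is_club P lambda E &
     forall A, E A -> le_kappa kappa le A P) ->
  has_FN lambda kappa P le.
Proof.
move=> rk rl kl po [E [Esub Ecof Ech] EP].
have [|N /Esub[]//|N /Esub[]//|Y YP Yl||N EN|F [Fl Fle]] :=
    @Kueker kappa lambda P le rk rl kl po P E.
- exact: subset_refl.
- by apply: Ecof.
- by move=> d A dl _; exact: Ech.
- rewrite (_ : P `&` N = N); first exact: EP.
  by have [NP _] := Esub _ EN; apply/seteqP; split=> [x []//|x Nx]; split=> //; exact: NP.
by apply: (has_FN_of_fin_closed rk rl kl po Fl Fle); exists P.
Qed.

(** If [A] is closed under [f], an interpolant between [a] in [A] and [p] belongs to [f a], hence to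
    [A], and to [g p]. So the relevant part of [g p] inside [A] is cofinal or coinitial. *)
Lemma has_FN_club (kappa lambda P : V) (le : V -> V -> Prop) :
  is_regular kappa -> is_regular lambda -> kappa ∈ lambda ->
  has_FN lambda kappa P le ->
  exists2 E : set (set V), is_club P lambda E &
     forall A, E A -> le_kappa kappa le A P.
Proof.
move=> rk rl kl [f [g [fgP FN]]].
have [cl ik il] : [/\ is_cardinal lambda, infinite_set kappa & infinite_set lambda].
  by case: rk rl => [_ ? _] [? ? _].
pose E A := [/\ A `<=` P, A #< lambda & forall a, A a -> f a `<=` A].
exists E; last first.
  move=> A [AP Al Af] p Pp; have [_ [_ gk]] := fgP _ Pp; split.
    exists [set r | [/\ g p r, A r & le r p]].
      split=> [r []//|a [Aa /= ap]].
      have [[r [fr gr ar rp]] _] := FN _ _ (AP _ Aa) Pp ap.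
      by exists r => //; split=> //; exact: Af fr.
    by apply: cle_lt_trans gk; apply: subset_card_le => r [].
  exists [set r | [/\ g p r, A r & le p r]].
    split=> [r []//|a [Aa /= pa]].
    have [_ [r [gr fr pr ra]]] := FN _ _ Pp (AP _ Aa) pa.
    by exists r => //; split=> //; exact: Af fr.
  by apply: cle_lt_trans gk; apply: subset_card_le => r [].
split=> [A []//|A [AP Al]|d A dl d0 EA mono].
  (* The unary [f] is presented as a function of finite sets, so that [fin_closure] provides the
     closed supersets. *)
  pose F (s : {fset V}) := \bigcup_(x in [set` s] `&` P) f x.
  have Fl s : F s #< lambda.
    apply: regular_bigcup => // [|x [_ /fgP[[]]]//].
    apply: finite_clt => //; apply: sub_finite_set (finite_fset s); exact: subIsetl.
  exists (fin_closure F A); last exact: sub_fin_closure.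
  split; [|exact: (fin_closure_clt rl ik kl)|].
    apply: fin_closure_min => // s sP x [y [ys Py]]; have [[fP _] _] := fgP _ Py.
    exact: fP.
  move=> a Na x fx; have Pa : a ∈ P.
    move: a Na {fx}; apply: fin_closure_min => // s sP y [z [_ Pz]].
    by have [[fP _] _] := fgP _ Pz; exact: fP.
  apply: (@fin_closure_closed _ F A [fset a]%fset).
    by move=> y /=; rewrite inE => /eqP->.
  by exists a => //; split=> //=; rewrite inE.
split.
- by move=> x [a ad]; have [h _ _] := EA _ ad; exact: h.
- by apply: regular_bigcup => //; [exact: cardinal_clt|move=> a /EA[]].
- move=> x [a ad Ax] y fy; exists a => //.
  by have [_ _ h] := EA _ ad; exact: (h _ Ax).
Qed.

(** * Elementary submodels *)

Fixpoint fbound (phi : formula) : nat :=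
  match phi with
  | FEq i j | FIn i j | FLe i j => maxn i.+1 j.+1
  | FNot phi => fbound phi
  | FAnd phi psi => maxn (fbound phi) (fbound psi)
  | FEx i phi => maxn i.+1 (fbound phi)
  end.

Lemma sat_ext le D phi e e' : (forall i, (i < fbound phi)%N -> e i = e' i) ->
  sat le D phi e <-> sat le D phi e'.
Proof.
elim: phi e e' => [i j|i j|i j|phi IH|phi IHphi psi IHpsi|i phi IH] e e' /= h.
1-3: by rewrite (h i) ?(h j) // leq_max ltnSn ?orbT.
- by have [h1 h2] := IH _ _ h; split=> n s; apply: n; [exact: h2|exact: h1].
- have [|h1 h2] := IHphi e e'; first by move=> i il; apply: h; rewrite leq_max il.
  have [|h3 h4] := IHpsi e e'; first by move=> i il; apply: h; rewrite leq_max il orbT.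
  by split=> -[s t]; split; [exact: h1|exact: h3|exact: h2|exact: h4].
have {}IH x : sat le D phi [eta e with i |-> x] <-> sat le D phi [eta e' with i |-> x].
  by apply: IH => j jl /=; case: eqP => // _; apply: h; rewrite leq_max jl orbT.
by split=> -[x Dx /IH s]; exists x.
Qed.

Lemma Tarski_Vaught le (M D : set V) : M !=set0 -> M `<=` D ->
  (forall phi i e, (forall j, M (e j)) ->
    (exists2 x, D x & sat le D phi [eta e with i |-> x]) ->
    exists2 x, M x & sat le D phi [eta e with i |-> x]) ->
  elementary le M D.
Proof.
move=> M0 MD TV; split=> //.
elim=> [i j|i j|i j|phi IH|phi IHphi psi IHpsi|i phi IH] e Me //=.
- by have [h1 h2] := IH _ Me; split=> n s; apply: n; [exact: h2|exact: h1].
- have [h1 h2] := IHphi _ Me; have [h3 h4] := IHpsi _ Me.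
  by split=> -[s t]; split; [exact: h1|exact: h3|exact: h2|exact: h4].
have Me' x : M x -> forall j, M ([eta e with i |-> x] j) by move=> Mx j /=; case: eqP.
split=> [[x Mx /(IH _ (Me' _ Mx)) s]|]; first by exists x => //; exact: MD.
by move=> /(TV _ _ _ Me)[x Mx /(IH _ (Me' _ Mx)) s]; exists x.
Qed.

Lemma elementary_ex le (M D : set V) phi i e : elementary le M D ->
  (forall j, M (e j)) -> (exists2 x, D x & sat le D phi [eta e with i |-> x]) ->
  exists2 x, M x & sat le D phi [eta e with i |-> x].
Proof.
move=> [_ _ el] Me /(el (FEx i phi) _ Me)[x Mx s]; exists x => //.
by apply/(el phi) => // j /=; case: eqP.
Qed.

Lemma elementary_bigcup J le (I : set J) (A : J -> set V) (D : set V) : I !=set0 ->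
  (forall i j, I i -> I j -> A i `<=` A j \/ A j `<=` A i) ->
  (forall i, I i -> elementary le (A i) D) -> elementary le (\bigcup_(i in I) A i) D.
Proof.
move=> [i0 Ii0] tot el; apply: Tarski_Vaught.
- by have [[x Ax] _ _] := el _ Ii0; exists x; exists i0.
- by move=> x [i /el[_ h _]]; exact: h.
move=> phi i e Me ex.
have [|x|j Ij Aj] := @seq_directed _ _ I A (map e (iota 0 (fbound phi))) _ tot.
- by exists i0.
- by move=> /mapP[j _ ->]; exact: Me.
have [[x0 Ax0] _ _] := el _ Ij.
(* One member [A j] contains all parameters that the formula can see; the other variables are reset
   to a point of [A j]. *)
pose e' n := if (n < fbound phi)%N then e n else x0.
have eE x : sat le D phi [eta e with i |-> x] <-> sat le D phi [eta e' with i |-> x].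
  by apply: sat_ext => n nl /=; rewrite /e' nl.
have [||x Ax /eE s] := @elementary_ex le (A j) D phi i e' (el _ Ij).
- move=> n; rewrite /e'; case: ifP => // nl; apply: Aj; apply: map_f.
  by rewrite mem_iota.
- by have [y Dy /eE sy] := ex; exists y.
- by exists x => //; exists j.
Qed.

(** Formulas are encoded in a countable type of labelled trees in order to count them. *)
Fixpoint fcode (phi : formula) : GenTree.tree nat :=
  match phi with
  | FEq i j => GenTree.Node 0 [:: GenTree.Leaf i; GenTree.Leaf j]
  | FIn i j => GenTree.Node 1 [:: GenTree.Leaf i; GenTree.Leaf j]
  | FLe i j => GenTree.Node 2 [:: GenTree.Leaf i; GenTree.Leaf j]
  | FNot phi => GenTree.Node 3 [:: fcode phi]
  | FAnd phi psi => GenTree.Node 4 [:: fcode phi; fcode psi]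
  | FEx i phi => GenTree.Node 5 [:: GenTree.Leaf i; fcode phi]
  end.

Lemma fcode_inj : injective fcode.
Proof.
elim=> [i j|i j|i j|phi IH|phi IHphi psi IHpsi|i phi IH] [i' j'|i' j'|i' j'|phi'|phi' psi'|i' phi'] //=.
1-3: by case=> -> ->.
- by case=> /IH ->.
- by case=> /IHphi -> /IHpsi ->.
- by case=> -> /IH ->.
Qed.

Lemma formula_countable : countable [set: formula].
Proof.
apply: card_le_trans (countableP [set: GenTree.tree nat]).
by apply: (@cle_fun _ _ _ _ fcode) => // x y _ _; exact: fcode_inj.
Qed.

(** * Small elementary submodels whose trace on [lambda] is an ordinal *)

Section Models.
Variables (kappa lambda : V) (D : set V) (le : V -> V -> Prop).
Hypotheses (rkappa : is_regular kappa) (rlambda : is_regular lambda)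
  (hlt : kappa ∈ lambda) (lD : lambda `<=` D).

Let ck : is_cardinal kappa. Proof. by case: rkappa. Qed.
Let cla : is_cardinal lambda. Proof. by case: rlambda. Qed.
Let ik : infinite_set kappa. Proof. by case: rkappa. Qed.
Let il : infinite_set lambda. Proof. by case: rlambda. Qed.
Let kl : members kappa #< lambda. Proof. exact: cardinal_clt. Qed.
Let ola : is_ordinal lambda. Proof. by case: cla. Qed.
Let tla : transitive_set lambda. Proof. by case: ola. Qed.

(** These are models as in (4), the trace [g] being at least as large as the model. Including
    [kappa] in [g] makes [g] infinite and keeps the notion stable under unions of at most [kappa]
    models. *)
Definition good_model (N : set V) := exists g : V,
  [/\ g ∈ lambda, N `&` lambda = g, N #<= g, kappa `<=` g & elementary le N D].

Lemma good_model_clt N : good_model N -> N #< lambda.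
Proof. by move=> [g [gl _ Ng _ _]]; apply: cle_lt_trans Ng _; exact: cardinal_clt. Qed.

(** A union of ordinals is an ordinal, and regularity bounds this one below [lambda]. *)
Lemma initial_segment J (I : set J) (h : J -> V) (S : set V) : I #< lambda ->
  (forall i, I i -> h i ∈ lambda) -> S = \bigcup_(i in I) members (h i) ->
  exists2 g, g ∈ lambda & members g = S.
Proof.
move=> Il hl SE; have [b bl hb] := regular_bound rlambda Il hl.
have [|g gS] := @small_set S lambda.
  by apply: subset_card_le; rewrite SE => x [i Ii]; exact: (tla (hl _ Ii)).
exists g => //; have og : is_ordinal g.
  apply: ordinal_of_transitive => x; rewrite gS SE => -[i Ii xh].
    move=> y yx; exists i => //; have [t _ _ _] := mem_ordinal ola (hl _ Ii).
    exact: (t _ xh).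
  exact: (ordinal_transitive (mem_ordinal ola (hl _ Ii)) xh).
have ob := mem_ordinal ola bl; have [tb _ _ _] := ob.
have [|h1|-> //] := ordinal_sub og ob.
  by rewrite gS SE => x [i Ii]; apply: tb; exact: hb.
by apply: (tla bl).
Qed.

Lemma good_model_bigcup (d : V) (A : V -> set V) : d ∈ lambda -> d #<= kappa ->
  d !=set0 -> (forall a, a ∈ d -> good_model (A a)) ->
  (forall a b, a ∈ d -> b ∈ d -> a ∈ b -> A a `<=` A b) ->
  good_model (\bigcup_(a in d) A a).
Proof.
move=> dl dk d0 gA mono; have od := mem_ordinal ola dl.
have /choice [h hP] : forall a, exists g : V, a ∈ d ->
  [/\ g ∈ lambda, A a `&` lambda = g, A a #<= g, kappa `<=` g & elementary le (A a) D].
  move=> a; case: (pselect (a ∈ d)) => [/gA[g gP]|n]; first by exists g.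
  by exists vempty.
have [|g gl gE] := @initial_segment _ (members d) h ((\bigcup_(a in d) A a) `&` lambda)
    (cardinal_clt cla dl) (fun a ad => let: And5 x _ _ _ _ := hP a ad in x).
  rewrite setI_bigcupl; apply: eq_bigcupr => a ad; by have [_ -> _ _ _] := hP _ ad.
have hg a : a ∈ d -> h a `<=` g.
  move=> ad; have [_ <- _ _ _] := hP _ ad; rewrite gE => x [Ax xl].
  by split=> //; exists a.
have [a0 ad0] := d0.
have kg : kappa `<=` g by apply: subset_trans (hg _ ad0); have [] := hP _ ad0.
have ig : infinite_set g by apply: infinite_cle ik _; exact: subset_card_le.
exists g; split=> //.
  (* The length of the chain matters here: at most [kappa] models of size at most [g] have a union
     of size at most [g], as [kappa] is included in [g]. *)
  apply: bigcup_clei => //.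
    by apply: (card_le_trans dk); exact: subset_card_le.
  move=> a ad; have [_ _ Ah _ _] := hP _ ad; apply: (card_le_trans Ah).
  by apply: subset_card_le; exact: hg.
apply: elementary_bigcup => //; last by move=> a /hP[].
move=> i j id jd; have [h1|->|h1] := ordinal_trichotomy (mem_ordinal od id) (mem_ordinal od jd).
- by left; exact: mono.
- by left; exact: subset_refl.
- by right; exact: mono.
Qed.

(** A Skolem hull, closed off so that its trace on [lambda] is an ordinal of the
    same cardinality as the hull. *)
Lemma good_model_cofinal Y : Y `<=` D -> Y #< lambda ->
  exists2 N, good_model N & Y `<=` N.
Proof.
move=> YD Yl.
have [k0 kk0] : members kappa !=set0 by exact: infinite_setN0.
have Dk0 : D k0 by apply: lD; exact: (tla hlt).
(* Skolem functions: [w] takes a formula, the variable to be witnessed and a finite list of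
   parameters. The value is [k0] when there is no witness. *)
have /choice [w wP] : forall t : (formula * nat) * seq V, exists x, D x /\
   ((exists2 x, D x & sat le D t.1.1 [eta nth vempty t.2 with t.1.2 |-> x]) ->
    sat le D t.1.1 [eta nth vempty t.2 with t.1.2 |-> x]).
  move=> t; case: (pselect (exists2 x, D x & sat le D t.1.1 [eta nth vempty t.2 with t.1.2 |-> x])).
    by move=> [x Dx s]; exists x.
  by move=> n; exists k0.
(* [ga Z] is an ordinal below [lambda] that includes [kappa] and the trace of [Z] and is at least as
   large as [Z]. Each round [St] adds its elements, so that trace and size keep up with the hull. *)
have /choice [ga gaP] : forall Z : set V, exists g : V, Z #< lambda ->
    [/\ g ∈ lambda, Z `&` lambda `<=` g, Z #<= g & kappa `<=` g].
  move=> Z; case: (pselect (Z #< lambda)) => Zl; last by exists vempty.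
  have [||b bl bP] := @regular_bound _ lambda (Z `&` lambda) id rlambda.
  - by apply: cle_lt_trans Zl; apply: subset_card_le; exact: subIsetl.
  - by move=> x [].
  have [a [al _ Za _]] := clt_cardinal cla Zl.
  have mx x y : x ∈ lambda -> y ∈ lambda -> exists2 z, z ∈ lambda & x `<=` z /\ y `<=` z.
    move=> xl yl; have [h|h] := ordinal_total (mem_ordinal ola xl) (mem_ordinal ola yl).
      by exists y; [|split; [exact: h|exact: subset_refl]].
    by exists x; [|split; [exact: subset_refl|exact: h]].
  have [c cl [ac bc]] := mx _ _ al bl; have [g gl [cg kg]] := mx _ _ cl hlt.
  exists g => _; split=> //.
    by move=> x /bP xb; apply: cg; exact: bc.
  by apply: (card_le_trans Za); apply: subset_card_le; exact: subset_trans cg.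
pose St (Z : set V) := Z `|` (w @` (setT `*` seq_of Z) `|` ga Z).
pose Zn n := iter n St Y.
have ctF : [set: formula * nat] #<= [set: nat].
  rewrite -setXTT; apply: (card_le_trans (setX_cle formula_countable (card_lexx _))).
  by rewrite setXTT; have /card_eqPle[] := card_nat2.
have gai Z : Z #< lambda -> infinite_set (ga Z).
  by move=> /gaP[_ _ _ kg]; apply: infinite_cle ik _; exact: subset_card_le.
have StP Z : Z `<=` D -> Z #< lambda -> St Z `<=` D /\ St Z #<= ga Z.
  move=> ZD Zl; have [gl _ Zg kg] := gaP _ Zl; have ig := gai _ Zl; split.
    move=> x [/ZD//|[[t _ <-]|xg]]; first by have [] := wP t.
    by apply: lD; exact: (tla gl).
  apply: (@card_le_trans _ _ _ (\bigcup_(o in [set: option bool])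
      if o is Some b then if b then Z else w @` (setT `*` seq_of Z) else ga Z)).
    by apply: subset_card_le => x [h|[h|h]]; [exists (Some true)|exists (Some false)|exists None].
  apply: bigcup_clei => //; first by have [] := finite_clt (@finite_finset _ [set: option bool]) ig.
  case=> [[]|] _ //; apply: (card_le_trans (card_image_le _ _)).
  apply: (@card_le_trans _ _ _ (members (ga Z) `*` members (ga Z))); last exact: (@cle_sqr _ _ (ga Z)).
  apply: setX_cle; first by apply: (card_le_trans ctF); exact/infiniteP.
  exact: seq_of_cle.
have ZnP n : Zn n `<=` D /\ Zn n #< lambda.
  elim: n => [|n [IHD IHl]] //; have [h1 h2] := StP _ IHD IHl; split=> //.
  by apply: (cle_lt_trans h2); have [gl _ _ _] := gaP _ IHl; exact: cardinal_clt.
pose N := \bigcup_(n in [set: nat]) Zn n.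
have gaN n : ga (Zn n) `<=` N by move=> x xg; exists n.+1 => //; right; right.
have natl : [set: nat] #< lambda by apply: cle_lt_trans kl; exact/infiniteP.
(* The trace of [N] is the union of the ordinals [ga (Zn n)]: each includes the trace of its stage
   and is added in the next one. *)
have [n _||g gl gE] := @initial_segment _ [set: nat] (fun n => ga (Zn n)) (N `&` lambda) natl.
- by have [_ /gaP[]] := ZnP n.
- apply/seteqP; split=> x.
    move=> [[n _ Zx] xl]; exists n => //.
    by have [_ /gaP[_ h _ _]] := ZnP n; apply: h.
  move=> [n _ xg]; split; first exact: gaN xg.
  by have [_ /gaP[gl _ _ _]] := ZnP n; exact: (tla gl).
have gag n : ga (Zn n) `<=` g.
  rewrite gE => x xg; split; first exact: gaN xg.
  by have [_ /gaP[gl' _ _ _]] := ZnP n; exact: (tla gl').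
have kg : kappa `<=` g by have [_ /gaP[_ _ _ h]] := ZnP 0%N; apply: subset_trans h _.
have ig : infinite_set g by apply: infinite_cle ik _; exact: subset_card_le.
have ZS n : Zn n `<=` Zn n.+1 by move=> x; left.
have Zle m n : (m <= n)%N -> Zn m `<=` Zn n.
  elim: n => [|n IH]; first by rewrite leqn0 => /eqP ->; exact: subset_refl.
  by rewrite leq_eqVlt => /orP[/eqP->|/IH h]; [exact: subset_refl|exact: subset_trans (ZS n)].
exists N; last by move=> x Yx; exists 0%N.
exists g; split=> //.
  apply: bigcup_clei => // [|n _]; first exact/infiniteP.
  have [_ /gaP[_ _ h _]] := ZnP n; apply: (card_le_trans h).
  by apply: subset_card_le; exact: gag.
apply: Tarski_Vaught.
- by exists k0; have /kg : k0 ∈ kappa := kk0; rewrite gE => -[].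
- by move=> x [n _]; have [h _] := ZnP n; exact: h.
move=> phi i e Ne ex.
have [|m n _ _|x|n _ Zs] := @seq_directed _ _ [set: nat] Zn (map e (iota 0 (fbound phi))).
- by exists 0%N.
- by case/orP: (leq_total m n) => /Zle; [left|right].
- by move=> /mapP[j _ ->]; exact: Ne.
(* The values of the variables below [fbound phi] suffice, and this finite list lies in one
   stage. *)
pose t := ((phi, i), map e (iota 0 (fbound phi))).
have eE x : sat le D phi [eta e with i |-> x] <-> sat le D phi [eta nth vempty t.2 with i |-> x].
  apply: sat_ext => j jl /=; case: eqP => // _.
  by rewrite (nth_map 0%N) ?size_iota // nth_iota.
have [Dw wS] := wP t; exists (w t).
  by exists n.+1 => //; right; left; exists t.
by apply/eE/wS; have [x Dx /eE s] := ex; exists x.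
Qed.

Lemma small_models_FN (P : V) : P `<=` D -> is_partial_order P le ->
  (forall M : V, elementary le M D -> vcard M `<=` vinter M lambda ->
     vinter M lambda ∈ lambda -> le_kappa kappa le (P `&` M) P) ->
  has_FN lambda kappa P le.
Proof.
move=> PD po H.
have [|N gN||||F [Fl Fle]] := @Kueker kappa lambda P le rkappa rlambda hlt po D good_model PD.
- by move=> N [g [_ _ _ _ []]].
- exact: good_model_clt.
- exact: good_model_cofinal.
- exact: good_model_bigcup.
- move=> N [g [gl gE Ng kg el]].
  (* The class [N] is a set because it is no larger than the set [g]. *)
  have [M MN] := small_set Ng.
  have vE : vinter M lambda = g.
    by apply: V_ext; rewrite -gE -MN; apply/seteqP; split=> x /mem_vinter.
  rewrite -MN; apply: H; rewrite ?vE ?MN //.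
  have [k [ck' Mk kM]] := small_card (card_lexx M).
  have : is_cardinal (vcard M) /\ vcard M #= M.
    rewrite /vcard; apply: (@xgetPex _ vempty [set k | is_cardinal k /\ k #= M]).
    by exists k; split=> //; apply/card_eqPle.
  move=> [cM /card_eqPle[vM _]]; apply: cardinal_sub => //.
    exact: mem_ordinal gl.
  by apply: (card_le_trans vM); rewrite MN.
by apply: (has_FN_of_fin_closed rkappa rlambda hlt po Fl Fle); exists P.
Qed.

End Models.

(** * Coding the Freese-Nation property in a model *)

Definition vupair (x y : V) : V := vfamily (fun b : bool => if b then x else y).
Definition vpair (x y : V) : V := vupair (vupair x x) (vupair x y).
Definition vtriple (x y z : V) : V := vpair x (vpair y z).

Lemma mem_vupair x y z : z ∈ vupair x y <-> z = x \/ z = y.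
Proof.
split=> [/mem_vfamily[[] <-]|[->|->]]; [by left|by right| |];
  apply/mem_vfamily; [by exists true|by exists false].
Qed.

Lemma vpair_inj x y x' y' : vpair x y = vpair x' y' -> x = x' /\ y = y'.
Proof.
move=> e.
have mp a b z : z ∈ vpair a b <-> z = vupair a a \/ z = vupair a b by exact: mem_vupair.
have up a b c : vupair a a = vupair b c -> a = b /\ a = c.
  move=> h; have := mem_vupair b c b; have := mem_vupair b c c; rewrite -h.
  by move=> [_ /(_ (or_intror erefl)) /mem_vupair[]->] [_ /(_ (or_introl erefl)) /mem_vupair[]->].
have xx : x = x'.
  have := (mp x y (vupair x x)).2 (or_introl erefl).
  by rewrite e => /mp[/up[]|/up[]].
split=> //; subst x'.
have : vupair x y ∈ vpair x y by apply/mp; right.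
have : vupair x y' ∈ vpair x y by rewrite e; apply/mp; right.
have yy a b : vupair x a = vupair x b -> a = b \/ a = x.
  move=> h; have : a ∈ vupair x b by rewrite -h; apply/mem_vupair; right.
  by move=> /mem_vupair[]; [right|left].
move=> /mp h1; rewrite e => /mp h2.
have [h|h] : y = x \/ y = y' by case: h2 => [/yy[]|/yy[]]; tauto.
  have [h'|h'] : y' = x \/ y' = y by case: h1 => [/yy[]|/yy[]]; tauto.
    by rewrite h h'.
  by [].
by [].
Qed.

Lemma vtriple_inj x y z x' y' z' : vtriple x y z = vtriple x' y' z' ->
  [/\ x = x', y = y' & z = z'].
Proof. by move=> /vpair_inj[-> /vpair_inj[-> ->]]. Qed.

Lemma regular_setX T U (A : set T) (B : set U) (k : V) : is_regular k ->
  A #< k -> B #< k -> A `*` B #< k.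
Proof.
move=> rk Ak Bk; apply: (@cle_lt_trans _ _ _ _ (\bigcup_(a in A) (pair a @` B))).
  by apply: subset_card_le => -[a b] [/= Aa Bb]; exists a => //; exists b.
apply: regular_bigcup => // a _; apply: cle_lt_trans Bk; exact: card_image_le.
Qed.

(** * Formulas for triples over a transitive class closed under small subsets *)

Definition FImp phi psi := FNot (FAnd phi (FNot psi)).
Definition FAll i phi := FNot (FEx i (FNot phi)).
Definition FOr phi psi := FImp (FNot phi) psi.
Definition FIff phi psi := FAnd (FImp phi psi) (FImp psi phi).

Definition upd (e : nat -> V) i x : nat -> V := [eta e with i |-> x].

Section Definability.
Variables (le : V -> V -> Prop) (D : set V) (theta : V).
Hypotheses (rtheta : is_regular theta)
  (Dtr : forall x y, D x -> y ∈ x -> D y)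
  (Dset : forall x : V, x `<=` D -> members x #< theta -> D x).

Let ith : infinite_set theta. Proof. by case: rtheta. Qed.

Lemma iff_imp phi psi e (A B : Prop) : (sat le D phi e <-> A) ->
  (sat le D psi e <-> B) -> (sat le D (FImp phi psi) e <-> (A -> B)).
Proof.
move=> [h1 h2] [h3 h4] /=; split=> [n /h2 a|ab [/h1 a nb]]; last by apply: nb; exact/h4/ab.
by apply/h3; apply: contrapT => nb; apply: n.
Qed.

Lemma iff_and phi psi e (A B : Prop) : (sat le D phi e <-> A) ->
  (sat le D psi e <-> B) -> (sat le D (FAnd phi psi) e <-> (A /\ B)).
Proof. by move=> [h1 h2] [h3 h4] /=; split=> [[/h1 a /h3 b]|[/h2 a /h4 b]]. Qed.

Lemma iff_not phi e (A : Prop) : (sat le D phi e <-> A) ->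
  (sat le D (FNot phi) e <-> ~ A).
Proof. by move=> [h1 h2] /=; split=> n a; apply: n; [exact: h2|exact: h1]. Qed.

Lemma iff_or phi psi e (A B : Prop) : (sat le D phi e <-> A) ->
  (sat le D psi e <-> B) -> (sat le D (FOr phi psi) e <-> (A \/ B)).
Proof.
move=> hA hB; have [h1 h2] := iff_imp (iff_not hA) hB; split=> [/h1 h|h].
  by case: (pselect A) => a; [left|right; exact: h].
by apply: h2 => na; case: h.
Qed.

Lemma iff_iff phi psi e (A B : Prop) : (sat le D phi e <-> A) ->
  (sat le D psi e <-> B) -> (sat le D (FIff phi psi) e <-> (A <-> B)).
Proof. by move=> hA hB; exact: (iff_and (iff_imp hA hB) (iff_imp hB hA)). Qed.

Lemma iff_ex i phi e (Q : V -> Prop) :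
  (forall x, D x -> (sat le D phi (upd e i x) <-> Q x)) ->
  (sat le D (FEx i phi) e <-> exists2 x, D x & Q x).
Proof. by move=> h; split=> -[x Dx s]; exists x => //; exact/(h _ Dx). Qed.

Lemma iff_all i phi e (Q : V -> Prop) :
  (forall x, D x -> (sat le D phi (upd e i x) <-> Q x)) ->
  (sat le D (FAll i phi) e <-> forall x, D x -> Q x).
Proof.
move=> h; split=> [n x Dx|q [x Dx]]; last by apply; apply/(h _ Dx)/q.
apply/(h _ Dx); apply: contrapT => nq; apply: n; by exists x.
Qed.

Lemma env_upd e i x : (forall j, D (e j)) -> D x ->
  forall j, D ((upd e i x) j).
Proof. by move=> De Dx j; rewrite /upd /=; case: eqP. Qed.

(** Here and in the formulas below, [n] is the first fresh variable: the free variables are meant to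
    be below [n], and only variables from [n] on are bound. *)
Definition FUpair n z x y :=
  FAll n (FIff (FIn n z) (FOr (FEq n x) (FEq n y))).
Definition FPair n z x y := FEx n (FEx n.+1 (FAnd (FUpair n.+2 n x x)
  (FAnd (FUpair n.+2 n.+1 x y) (FUpair n.+2 z n n.+1)))).
Definition FTriple n F x y z := FEx n (FEx n.+1 (FAnd (FPair n.+2 n y z)
  (FAnd (FPair n.+2 n.+1 x n) (FIn n.+1 F)))).

Lemma upd_lt (e : nat -> V) n i x : (i < n)%N -> (upd e n x) i = e i.
Proof. by move=> lt; rewrite /upd /= ltn_eqF. Qed.

Lemma upd_eq (e : nat -> V) n x : (upd e n x) n = x.
Proof. by rewrite /upd /= eqxx. Qed.

Lemma D_vupair x y : D x -> D y -> D (vupair x y).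
Proof.
move=> Dx Dy; apply: Dset => [z /mem_vupair[]->//|].
apply: finite_clt => //; apply: (sub_finite_set (B := [set x; y])); last exact: finite_set2.
by move=> z /mem_vupair.
Qed.

Lemma D_vpair x y : D x -> D y -> D (vpair x y).
Proof. by move=> Dx Dy; apply: D_vupair; exact: D_vupair. Qed.

Lemma D_vtriple x y z : D x -> D y -> D z -> D (vtriple x y z).
Proof. by move=> Dx Dy Dz; apply: D_vpair => //; exact: D_vpair. Qed.

Lemma sat_upair n z x y e : (z < n)%N -> (x < n)%N -> (y < n)%N ->
  (forall j, D (e j)) ->
  sat le D (FUpair n z x y) e <-> e z = vupair (e x) (e y).
Proof.
move=> zn xn yn De.
apply: (@iff_trans _ (forall w, D w -> (w ∈ e z <-> (w = e x \/ w = e y)))).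
  apply: iff_all => w Dw; apply: iff_iff; first by rewrite /= upd_eq upd_lt.
  by apply: iff_or; rewrite /= upd_eq upd_lt.
split=> [h|-> w _]; last exact: mem_vupair.
apply: V_ext; apply/seteqP; split=> w wz.
  by apply/mem_vupair/h => //; exact: Dtr wz.
by apply/h; [move: wz => /mem_vupair[]->|apply/mem_vupair].
Qed.

Lemma sat_pair n z x y e : (z < n)%N -> (x < n)%N -> (y < n)%N ->
  (forall j, D (e j)) ->
  sat le D (FPair n z x y) e <-> e z = vpair (e x) (e y).
Proof.
move=> zn xn yn De; apply: (@iff_trans _ (exists2 u, D u & exists2 v, D v &
    u = vupair (e x) (e x) /\ v = vupair (e x) (e y) /\ e z = vupair u v)).
  apply: iff_ex => u Du; apply: iff_ex => v Dv.
  set e' := upd (upd e n u) n.+1 v.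
  have De' j : D (e' j) by do 2! apply: env_upd => //.
  have ex : e' x = e x by rewrite /e' !upd_lt // ltnS ltnW.
  have ey : e' y = e y by rewrite /e' !upd_lt // ltnS ltnW.
  have ez : e' z = e z by rewrite /e' !upd_lt // ltnS ltnW.
  have eu : e' n = u by rewrite /e' upd_lt // upd_eq.
  have ev : e' n.+1 = v by rewrite /e' upd_eq.
  have lt i : (i < n)%N -> (i < n.+2)%N by move=> h; exact: (ltn_trans h).
  have lt0 : (n < n.+2)%N by [].
  apply: iff_and; first by rewrite -[X in X = _]eu -ex; apply: sat_upair => //; exact: lt.
  apply: iff_and; first by rewrite -[X in X = _]ev -ex -ey; apply: sat_upair => //; exact: lt.
  by rewrite -eu -[v in vupair _ v]ev -ez; apply: sat_upair => //; exact: lt.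
split=> [[u Du [v Dv [-> [-> ->]]]]//|->].
by exists (vupair (e x) (e x)); [exact: D_vupair|exists (vupair (e x) (e y)); [exact: D_vupair|]].
Qed.

Lemma sat_triple n F x y z e : (F < n)%N -> (x < n)%N -> (y < n)%N -> (z < n)%N ->
  (forall j, D (e j)) ->
  sat le D (FTriple n F x y z) e <-> vtriple (e x) (e y) (e z) ∈ e F.
Proof.
move=> Fn xn yn zn De; apply: (@iff_trans _ (exists2 u, D u & exists2 v, D v &
    u = vpair (e y) (e z) /\ v = vpair (e x) u /\ v ∈ e F)).
  apply: iff_ex => u Du; apply: iff_ex => v Dv.
  set e' := upd (upd e n u) n.+1 v.
  have De' j : D (e' j) by do 2! apply: env_upd => //.
  have eE i : (i < n)%N -> e' i = e i by move=> h; rewrite /e' !upd_lt // ltnS ltnW.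
  have eu : e' n = u by rewrite /e' upd_lt // upd_eq.
  have ev : e' n.+1 = v by rewrite /e' upd_eq.
  have lt i : (i < n)%N -> (i < n.+2)%N by move=> h; exact: (ltn_trans h).
  have lt0 : (n < n.+2)%N by [].
  apply: iff_and; first by rewrite -[X in X = _]eu -!eE //; apply: sat_pair => //; exact: lt.
  apply: iff_and; first by rewrite -[v in v = _]ev -eu -!eE //; apply: sat_pair => //; exact: lt.
  by rewrite -[v in v ∈ _]ev -!eE.
split=> [[u Du [v Dv [-> [-> ?]]]]//|h].
exists (vpair (e y) (e z)); first exact: D_vpair.
by exists (vtriple (e x) (e y) (e z)) => //; exact: D_vtriple.
Qed.

(** The triples of a relation between small subsets of [D] form a small subset of [D], which is
    therefore an element of [D]. *)
Lemma triple_code (R : V -> V -> V -> Prop) (A B C : V) : 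
  A `<=` D -> B `<=` D -> C `<=` D ->
  members A #< theta -> members B #< theta -> members C #< theta ->
  (forall a b c, R a b c -> [/\ a ∈ A, b ∈ B & c ∈ C]) ->
  exists2 F, D F & forall a b c, vtriple a b c ∈ F <-> R a b c.
Proof.
move=> AD BD CD At Bt Ct RABC.
pose F := vfamily (fun t : {t : idx A * idx B * idx C | R (elt t.1.1) (elt t.1.2) (elt t.2)} =>
  let: exist t _ := t in vtriple (elt t.1.1) (elt t.1.2) (elt t.2)).
have FE x : x ∈ F <-> exists a b c, R a b c /\ x = vtriple a b c.
  split=> [/mem_vfamily[[[[i j] k] Rt] /= <-]|[a [b [c [Rt ->]]]]].
    by exists (elt i), (elt j), (elt k).
  have [[i ia] [j jb] [k kc]] := RABC _ _ _ Rt; subst a b c.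
  by apply/mem_vfamily; exists (exist _ ((i, j), k) Rt).
exists F; last first.
  move=> a b c; split=> [/FE[a' [b' [c' [Rt /vtriple_inj[-> -> ->]]]]]//|Rt].
  by apply/FE; exists a, b, c.
apply: Dset.
  move=> x /FE[a [b [c [/RABC[Aa Bb Cc] ->]]]].
  by apply: D_vtriple; [exact: AD|exact: BD|exact: CD].
apply: (@cle_lt_trans _ _ _ _ (A `*` B `*` C)); last by do 2! apply: regular_setX => //.
apply: (@cle_surj _ _ _ _ (fun t => vtriple t.1.1 t.1.2 t.2)).
by move=> x /FE[a [b [c [/RABC[Aa Bb Cc] ->]]]]; exists ((a, b), c).
Qed.

Lemma D_ordinal a : a ∈ theta -> D a.
Proof.
have [[oth _] _ _] := rtheta; have [tth _ _ _] := oth.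
elim/(well_founded_ind mem_wf): a => a IH ath; apply: Dset.
  by move=> b ba; apply: IH => //; exact: (tth _ ath).
by apply: cardinal_clt => //; case: rtheta.
Qed.

End Definability.

Definition FTrans n x :=
  FAll n (FImp (FIn n x) (FAll n.+1 (FImp (FIn n.+1 n) (FIn n.+1 x)))).

Definition FOrd n x := FAnd (FTrans n x) (FAll n (FImp (FIn n x) (FTrans n.+1 n))).

(** [FLe n n] expresses membership in [P], since [le] is reflexive there and relates nothing else.
    No parameter for [P] is needed. *)
Definition FBounded n F L := FAnd
  (FAll n (FImp (FLe n n) (FEx n.+1 (FAnd (FIn n.+1 L)
    (FAll n.+2 (FAll n.+3 (FImp (FTriple n.+4 F n n.+2 n.+3) (FIn n.+2 n.+1))))))))
  (FAll n (FAll n.+1 (FAll n.+2 (FAll n.+3 (FImp (FTriple n.+4 F n n.+1 n.+2)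
    (FImp (FTriple n.+4 F n n.+1 n.+3) (FEq n.+2 n.+3))))))).

Definition FInterp n F G := FAll n (FAll n.+1 (FImp (FLe n n.+1) (FEx n.+2
  (FAnd (FLe n n.+2) (FAnd (FLe n.+2 n.+1)
    (FAnd (FEx n.+3 (FTriple n.+4 F n n.+3 n.+2))
          (FEx n.+3 (FTriple n.+4 G n.+1 n.+3 n.+2)))))))).

Definition FCode n L K F G := FAnd (FOrd n K) (FAnd (FBounded n F L)
  (FAnd (FBounded n G K) (FAnd (FInterp n F G) (FInterp n G F)))).

(** As [kappa] may be missing from a model, the model can only be asked for some [K]; minimality
    then forces [K] to be at most [kappa]. *)
Definition FMinCode n L K F G := FAnd (FCode n L K F G)
  (FAll n (FImp (FIn n K) (FAll n.+1 (FAll n.+2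
    (FNot (FCode n.+3 L n n.+1 n.+2)))))).

(** The constant first entry [L] of the triples is a placeholder that lets [FTriple] also describe a
    map onto [P]. *)
Definition FOnto n L F := FAnd (FOrd n L) (FAnd
  (FAll n (FImp (FLe n n) (FEx n.+1 (FAnd (FIn n.+1 L) (FTriple n.+2 F L n.+1 n)))))
  (FAll n (FAll n.+1 (FAll n.+2 (FImp (FTriple n.+3 F L n n.+1)
    (FImp (FTriple n.+3 F L n n.+2) (FEq n.+1 n.+2))))))).

(** * Reflecting codes into elementary submodels *)

Section Reflection.
Variables (le : V -> V -> Prop) (D : set V) (theta : V).
Hypotheses (rtheta : is_regular theta)
  (Dtr : forall x y, D x -> y ∈ x -> D y)
  (Dset : forall x : V, x `<=` D -> members x #< theta -> D x).

(** [F] codes a map [p |-> {r | (p, b, r) ∈ F}] whose values are enumerated in a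
    one-to-one fashion by ordinals [b] bounded by an element of [L]. *)
Definition bounded F (L : V) :=
  (forall p, D p -> le p p -> exists2 a, D a & a ∈ L /\
     forall b, D b -> forall r, D r -> vtriple p b r ∈ F -> b ∈ a) /\
  (forall p, D p -> forall b, D b -> forall r, D r -> forall r', D r' ->
     vtriple p b r ∈ F -> vtriple p b r' ∈ F -> r = r').

Definition interp F G := forall p, D p -> forall q, D q -> le p q ->
  exists2 r, D r & le p r /\ le r q /\
    (exists2 b, D b & vtriple p b r ∈ F) /\ (exists2 b, D b & vtriple q b r ∈ G).

Definition code L K F G := is_ordinal K /\ bounded F L /\ bounded G K /\
  interp F G /\ interp G F.

Definition onto_code (L F : V) := is_ordinal L /\
  (forall r, D r -> le r r -> exists2 b, D b & b ∈ L /\ vtriple L b r ∈ F) /\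
  (forall b, D b -> forall r, D r -> forall r', D r' ->
     vtriple L b r ∈ F -> vtriple L b r' ∈ F -> r = r').

(** The formula only concerns elements of [x] and their elements, so it is absolute for the
    transitive [D]; foundation supplies the remaining conditions on an ordinal. *)
Lemma sat_ord n x e : (x < n)%N -> (forall j, D (e j)) ->
  sat le D (FOrd n x) e <-> is_ordinal (e x).
Proof.
have tr m y e' : (y < m)%N -> (forall j, D (e' j)) ->
    sat le D (FTrans m y) e' <-> transitive_set (e' y).
  move=> ym De; apply: (@iff_trans _ (forall u, D u -> (u ∈ e' y -> forall v, D v -> v ∈ u -> v ∈ e' y))).
    apply: iff_all => u Du; apply: iff_imp; first by rewrite /= !upd_eq upd_lt.
    apply: iff_all => v Dv; apply: iff_imp => /=.
      by rewrite upd_eq upd_lt // upd_eq.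
    have ym1 : (y < m.+1)%N by rewrite ltnS ltnW.
    by rewrite upd_eq !(@upd_lt _ _ y).
  split=> [h u uy v vu|h u Du uy v Dv]; last exact: (h _ uy).
  by apply: (h u) => //; [exact: Dtr uy|apply: Dtr vu; exact: Dtr uy].
move=> xn De.
apply: (@iff_trans _ (transitive_set (e x) /\ forall u, D u -> (u ∈ e x -> transitive_set u))).
  apply: iff_and; first exact: tr.
  apply: iff_all => u Du; apply: iff_imp; first by rewrite /= !upd_eq upd_lt.
  by rewrite -[X in transitive_set X](upd_eq e n); apply: tr => //; exact: env_upd.
split=> [[t h]|o].
  by apply: ordinal_of_transitive => // u ux; apply: h => //; exact: Dtr ux.
by split; [case: o|move=> u _; exact: ordinal_transitive].
Qed.

Ltac solve_env := repeat (first [assumption | apply: env_upd]).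
(** Descends in parallel through a formula and its intended meaning, down to triples, ordinals and
    atoms. *)
Ltac solve_sat := repeat (first
  [ apply: iff_all; let x := fresh in let h := fresh in move=> x h
  | apply: iff_ex; let x := fresh in let h := fresh in move=> x h
  | apply: iff_imp | apply: iff_and | apply: iff_not | exact: iff_refl
  | match goal with |- sat _ _ (FTriple ?n ?F ?x ?y ?z) ?e <-> _ =>
      apply: (@sat_triple le D theta rtheta Dtr Dset n F x y z e);
      [by []|by []|by []|by []|solve_env] end
  | match goal with |- sat _ _ (FOrd ?n ?x) ?e <-> _ =>
      apply: (@sat_ord n x e); [by []|solve_env] end ]).

Lemma sat_onto e : (forall j, D (e j)) ->
  sat le D (FOnto 2 0 1) e <-> onto_code (e 0%N) (e 1%N).
Proof. move=> De. rewrite /FOnto /onto_code. solve_sat. Qed.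

Lemma sat_min_code e : (forall j, D (e j)) ->
  sat le D (FMinCode 4 0 1 2 3) e <-> code (e 0%N) (e 1%N) (e 2) (e 3) /\
  forall K', D K' -> K' ∈ e 1%N -> forall F, D F -> forall G, D G -> ~ code (e 0%N) K' F G.
Proof.
move=> De; rewrite /FMinCode /code /FCode /bounded /FBounded /interp /FInterp.
solve_sat.
Qed.

(** By uniqueness, [r] is definable from [p], [b] and [F]. *)
Lemma elementary_triple (M : set V) p b r F : elementary le M D ->
  M F -> M p -> M b -> D r -> vtriple p b r ∈ F ->
  (forall r', D r' -> vtriple p b r' ∈ F -> r' = r) -> M r.
Proof.
move=> el MF Mp Mb Dr prF uni; have [_ MD _] := el.
pose e := nth F [:: F; p; b].
have Me j : M (e j) by case: j => [|[|[|j]]] //; rewrite /e nth_default.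
have satE x : D x -> sat le D (FTriple 4 0 1 2 3) (upd e 3 x) <-> vtriple p b x ∈ F.
  by move=> Dx; apply: (@sat_triple le D theta rtheta Dtr Dset) => //; apply: env_upd => // j; exact: MD.
have [|x Mx] := @elementary_ex le M D (FTriple 4 0 1 2 3) 3 e el Me.
  by exists r => //; exact/satE.
by move=> /(satE _ (MD _ Mx)) h; rewrite -(uni x _ h) //; exact: MD.
Qed.

Lemma elementary_bound (M : set V) p F L : elementary le M D ->
  M F -> M p -> M L ->
  (exists2 a, D a & a ∈ L /\
     forall b, D b -> forall r, D r -> vtriple p b r ∈ F -> b ∈ a) ->
  exists2 a, M a & a ∈ L /\
     forall b, D b -> forall r, D r -> vtriple p b r ∈ F -> b ∈ a.
Proof.
move=> el MF Mp ML [a Da aP]; have [_ MD _] := el.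
pose e := nth F [:: F; p; L].
have Me j : M (e j) by case: j => [|[|[|j]]] //; rewrite /e nth_default.
pose phi := FAnd (FIn 3 2) (FAll 4 (FAll 5 (FImp (FTriple 6 0 1 4 5) (FIn 4 3)))).
have satE x : D x -> sat le D phi (upd e 3 x) <-> (x ∈ L /\
     forall b, D b -> forall r, D r -> vtriple p b r ∈ F -> b ∈ x).
  move=> Dx; have De j : D (e j) by exact: MD.
  rewrite /phi; solve_sat.
have [|x Mx] := @elementary_ex le M D phi 3 e el Me.
  by exists a => //; exact/satE.
by move=> /(satE _ (MD _ Mx)) h; exists x.
Qed.

Lemma elementary_onto (M : set V) : elementary le M D ->
  (exists2 L, D L & exists2 F, D F & onto_code L F) ->
  exists2 L, M L & exists2 F, M F & onto_code L F.
Proof.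
move=> el [L DL [F DF LF]]; have [[m0 Mm0] MD _] := el.
pose e (j : nat) := m0.
have De x y j : D x -> D y -> D (upd (upd e 0 x) 1 y j).
  by move=> Dx Dy; do 2! apply: env_upd => // {}j; exact: MD.
have [|L' ML' ex] := @elementary_ex le M D (FEx 1 (FOnto 2 0 1)) 0 e el (fun=> Mm0).
  exists L => //; exists F => //.
  by apply/(@sat_onto (upd (upd e 0 L) 1 F)) => // j; exact: De.
have Me1 j : M (upd e 0 L' j) by rewrite /upd /=; case: eqP.
have [|F' MF' s] := @elementary_ex le M D (FOnto 2 0 1) 1 (upd e 0 L') el Me1.
  exact: ex.
exists L' => //; exists F' => //; apply/(@sat_onto (upd (upd e 0 L') 1 F')) => // j.
by apply: De; exact: MD.
Qed.

(** A least [K] exists in [D] by foundation. Minimality is part of the formula, so the [K] found in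
    [M] has it too, with respect to all of [D]. *)
Lemma elementary_min_code (M : set V) L : elementary le M D -> M L ->
  (exists2 K, D K & exists2 F, D F & exists2 G, D G & code L K F G) ->
  exists2 K, M K & exists2 F, M F & exists2 G, M G & code L K F G /\
  forall K', D K' -> K' ∈ K -> forall F, D F -> forall G, D G -> ~ code L K' F G.
Proof.
move=> el ML ex; have [[m0 Mm0] MD _] := el; have DL := MD _ ML.
have [|K [DK [F DF [G DG KFG]]] Kmin] := @mem_min
    [set K | D K /\ exists2 F, D F & exists2 G, D G & code L K F G].
  by have [K DK KP] := ex; exists K.
pose e (j : nat) := L.
have De x y z j : D x -> D y -> D z -> D (upd (upd (upd e 1 x) 2 y) 3 z j).
  by move=> Dx Dy Dz; do 3! apply: env_upd => // {}j.
have Mupd e' i x : (forall j, M (e' j)) -> M x -> forall j, M (upd e' i x j).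
  by move=> Me' Mx j; rewrite /upd /=; case: eqP.
have [|K' MK' exK] := @elementary_ex le M D (FEx 2 (FEx 3 (FMinCode 4 0 1 2 3))) 1 e el (fun=> ML).
  exists K => //; exists F => //; exists G => //.
  apply/(@sat_min_code (upd (upd (upd e 1 K) 2 F) 3 G)) => [j|]; first exact: De.
  split=> // K' DK' KK' F' DF' G' DG' c; apply: (Kmin _ KK'); split=> //.
  by exists F' => //; exists G'.
have Me1 := Mupd e 1%N K' (fun=> ML) MK'.
have [|F' MF' exF] := @elementary_ex le M D (FEx 3 (FMinCode 4 0 1 2 3)) 2 _ el Me1.
  exact: exK.
have Me2 := Mupd _ 2 F' Me1 MF'.
have [|G' MG' s] := @elementary_ex le M D (FMinCode 4 0 1 2 3) 3 _ el Me2.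
  exact: exF.
exists K' => //; exists F' => //; exists G' => //.
apply/(@sat_min_code (upd (upd (upd e 1 K') 2 F') 3 G')) => // j.
by apply: De; exact: MD.
Qed.

(** Each [f p] is enumerated by ordinals below some [a] in [l], and a triple [(p, b, r)] records
    that [r] has index [b]. The bounds are claimed in [L], which may exceed [l]. *)
Lemma bounded_code (f : V -> set V) (P l L : V) : is_regular l -> P `<=` D ->
  (forall p q, le p q -> p ∈ P /\ q ∈ P) ->
  l ∈ theta -> members P #< theta -> l `<=` L -> (forall p, p ∈ P -> subsets_lt P l (f p)) ->
  exists2 F, D F & bounded F L /\ forall p r, p ∈ P -> f p r ->
    exists2 b, D b & vtriple p b r ∈ F.
Proof.
move=> rl PD leP lth Pth lL fP; have [cl _ _] := rl.
have [cth _ _] := rtheta; have [oth _] := cth; have [tth _ _ _] := oth.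
have lD : l `<=` D by move=> x xl; apply: (D_ordinal rtheta Dset); exact: (tth _ lth).
have [ol _] := cl; have [tl _ _ _] := ol.
have /choice [en enP] : forall p, exists ah : V * (V -> V), p ∈ P ->
    [/\ ah.1 ∈ l, forall r, f p r -> ah.2 r ∈ ah.1 &
      forall r r', f p r -> f p r' -> ah.2 r = ah.2 r' -> r = r'].
  move=> p; case: (pselect (p ∈ P)) => [/fP[_ /(clt_cardinal cl)[a [al _ fa _]]]|n].
    by have [h [h1 h2]] := cle_inv vempty fa; exists (a, h).
  by exists (vempty, id).
have [|||F DF FE] := @triple_code D theta rtheta Dset
    (fun p b r => [/\ p ∈ P, f p r & (en p).2 r = b]) P l P PD lD PD Pth.
- exact: cardinal_clt.
- exact: Pth.
- move=> p b r [Pp fr <-]; split=> //; last by have [h _] := fP _ Pp; exact: h.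
  by have [al h _] := enP _ Pp; apply: (tl _ al); exact: h.
exists F => //; split; last first.
  move=> p r Pp fr; exists ((en p).2 r); last exact/FE.
  by have [al h _] := enP _ Pp; apply: lD; apply: (tl _ al); exact: h.
split=> [p Dp /leP[Pp _]|p _ b _ r _ r' _ /FE[Pp fr e] /FE[_ fr' e']].
  have [al h _] := enP _ Pp; exists (en p).1; first exact: lD.
  by split; [exact: lL|move=> b _ r _ /FE[_ fr <-]; exact: h].
by have [_ _ h] := enP _ Pp; apply: h => //; rewrite e e'.
Qed.

Lemma has_FN_le_kappa (kappa lambda P M : V) :
  is_regular kappa -> is_regular lambda -> kappa ∈ lambda -> is_partial_order P le ->
  P `<=` D -> lambda ∈ theta -> members P #< theta -> has_FN lambda kappa P le ->
  elementary le M D -> vinter M lambda ∈ vsucc lambda ->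
  le_kappa kappa le (P `&` M) P.
Proof.
move=> rk rl kl po PD lth Pth [f [g [fgP FN]]] el Ml.
have [_ MD _] := el; have [leP lerefl leanti letr] := po.
have [cth ith _] := rtheta; have [oth _] := cth; have [tth _ _ _] := oth.
have [cl _ _] := rl; have [ol _] := cl; have [tl _ _ _] := ol.
have [ck ik _] := rk; have [ok _] := ck; have [tk _ _ _] := ok.
have Dord := D_ordinal rtheta Dset.
have seg x : x ∈ M -> x ∈ lambda -> x `<=` M.
  move=> xM xl y yx; suff /mem_vinter[] : y ∈ vinter M lambda by [].
  have og : is_ordinal (vinter M lambda).
    by move: Ml => /mem_vsucc[h|-> //]; exact: mem_ordinal h.
  by have [tg _ _ _] := og; apply: tg yx; apply/mem_vinter.
(* If [M] contains all of [P], then [p] itself forms the cofinal and the coinitial set. *)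
case: (pselect (P `<=` M)) => [PM|nPM].
  have -> : P `&` M = P by apply/seteqP; split=> [x []//|x Px]; split=> //; exact: PM.
  have fin1 (p : V) : [set p] #< kappa by apply: finite_clt => //; exact: finite_set1.
  by move=> p Pp; split; exists [set p] => //; split=> [x ->|a [Pa /= ap]];
    try (by split=> //; exact: lerefl); exists p.
(* A map from an ordinal [L] onto [P] exists in [D], hence also in [M]. If [L] were in [lambda], it
   would be included in [M], and so would [P]. *)
have [L [ML oL nLl]] : exists L, [/\ L ∈ M, is_ordinal L & ~ L ∈ lambda].
  have [p0 Pp0 _] : exists2 p, p ∈ P & ~ p ∈ M.
    apply: contrapT => h; apply: nPM => p Pp; apply: contrapT => nMp; apply: h.
    by exists p.
  have [k [ck' Pk kP]] := small_card (card_lexx P).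
  have [ok' _] := ck'.
  have kth : k ∈ theta.
    apply: contrapT => /(ordinal_notin oth ok') /subset_card_le tk'.
    by have [_ []] := Pth; exact: card_le_trans kP.
  have kD : k `<=` D by move=> x xk; apply: Dord; exact: (tth _ kth).
  have [b [bP bs]] := cle_onto Pp0 Pk.
  have [|||||F DF FE] := @triple_code D theta rtheta Dset
    (fun a c r => [/\ a = k, c ∈ k & b c = r]) (vupair k k) k P _ kD PD.
  - by move=> x /mem_vupair[]->; exact: Dord.
  - apply: finite_clt => //; apply: (sub_finite_set (B := [set k])); last exact: finite_set1.
    by move=> x /mem_vupair[]->.
  - exact: cardinal_clt.
  - exact: Pth.
  - by move=> a c r [-> ck2 <-]; split=> //; apply/mem_vupair; left.
  have [|L ML [F' MF' [oL [Lonto Luni]]]] := elementary_onto el.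
    exists k; first exact: Dord.
    exists F => //; split=> //; split=> [r Dr /leP[Pr _]|c _ r _ r' _ /FE[_ _ e] /FE[_ _ e']].
      have [c kc cr] := bs _ Pr; exists c; first exact: kD.
      by split=> //; apply/FE.
    by rewrite -e -e'.
  exists L; split=> // Ll; apply: nPM => r Pr.
  have [c Dc [cL cr]] := Lonto r (PD _ Pr) (lerefl _ Pr).
  apply: (@elementary_triple M L c r F' el MF' ML) => //; first exact: (seg L).
  - exact: PD.
  - by move=> r' Dr' h; apply: (Luni c Dc) => //; exact: PD.
(* The least such [L] stands in for [lambda], which may be missing from [M]: elements of [M] below
   [L] are below [lambda]. *)
have [|{ML oL nLl}L [ML oL nLl] Lmin] := @mem_min
    [set L | [/\ L ∈ M, is_ordinal L & ~ L ∈ lambda]].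
  by exists L.
have lL : lambda `<=` L by exact: ordinal_notin.
have LMl x : x ∈ L -> x ∈ M -> x ∈ lambda.
  move=> xL Mx; apply: contrapT => nxl; apply: (Lmin _ xL); split=> //.
  exact: mem_ordinal xL.
have kD : D kappa by apply: Dord; exact: (tth _ lth).
have kth : kappa ∈ theta by exact: (tth _ lth).
(* As [lambda] is included in [L], the given maps have codes with the bounds [L] and [kappa]. *)
have [F1 DF1 [F1b F1f]] : exists2 F, D F & bounded F L /\
    forall p r, p ∈ P -> f p r -> exists2 b, D b & vtriple p b r ∈ F.
  by apply: (@bounded_code f P lambda L) => // p /fgP[].
have [G1 DG1 [G1b G1g]] : exists2 G, D G & bounded G kappa /\
    forall p r, p ∈ P -> g p r -> exists2 b, D b & vtriple p b r ∈ G.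
  by apply: (@bounded_code g P kappa kappa) => // p /fgP[].
have code1 : code L kappa F1 G1.
  split=> //; split=> //; split=> //; split=> p Dp q Dq pq;
    have [Pp Pq] := leP _ _ pq; have [[r [fr gr pr rq]] [s [gs fs ps sq]]] := FN _ _ Pp Pq pq.
    exists r; first by apply: PD; have [] := leP _ _ pr.
    by split=> //; split=> //; split; [exact: F1f|exact: G1g].
  exists s; first by apply: PD; have [] := leP _ _ ps.
  by split=> //; split=> //; split; [exact: G1g|exact: F1f].
have [|K MK [F MF [G MG [[oK [Fb [Gb [FG GF]]]] Kmin]]]] := elementary_min_code el ML.
  by exists kappa => //; exists F1 => //; exists G1.
have Kk : K `<=` kappa.
  by apply: ordinal_notin => // kK; exact: (Kmin _ kD kK _ DF1 _ DG1 code1).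
(* The values of [G] at [q] are indexed by an element of [K], hence of [kappa], so there are fewer
   than [kappa] of them. *)
pose g' q := [set r | D r /\ exists2 b, D b & vtriple q b r ∈ G].
have g'lt q : q ∈ P -> g' q #< kappa.
  move=> Pq; have [Gb1 Gb2] := Gb; have Dq := PD _ Pq.
  have [a Da [aK aP]] := Gb1 _ Dq (lerefl _ Pq).
  apply: (@cle_lt_trans _ _ _ _ (members a)); last by apply: cardinal_clt => //; exact: Kk.
  apply: (@cle_surj _ _ _ _ (fun b => xget vempty [set r | D r /\ vtriple q b r ∈ G])).
  move=> r [Dr [b Db br]]; exists b; first exact: aP br.
  by apply: xget_unique => [|r' [Dr' br']]; [|exact: (Gb2 q Dq b)].
(* The indices at [a] have a bound [c] in both [M] and [L], hence in [lambda]. So every index below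
   [c] is in [M], and each index determines its value. *)
have fM a b r : a ∈ P -> a ∈ M -> D b -> D r -> vtriple a b r ∈ F -> r ∈ M.
  move=> Pa Ma Db Dr abr; have [Fb1 Fb2] := Fb; have Da := PD _ Pa.
  have [c Mc [cL cP]] := elementary_bound el MF Ma ML (Fb1 _ Da (lerefl _ Pa)).
  apply: (@elementary_triple M a b r F el MF Ma) => //.
    by apply: (seg c) => //; [exact: LMl|exact: cP abr].
  by move=> r' Dr' h; exact: (Fb2 a Da b).
move=> p Pp; have Dp := PD _ Pp; split.
  exists [set r | [/\ g' p r, r ∈ M & le r p]].
    split=> [r [_ Mr rp]|a [[Pa Ma] /= ap]].
      by split=> //; split=> //; have [] := leP _ _ rp.
    have Da := PD _ Pa.
    have [r Dr [ar [rp [[b Db abr] [c Dc pcr]]]]] := FG _ Da _ Dp ap.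
    exists r => //; split=> //; last exact: (fM a b).
    by split=> //; exists c.
  by apply: cle_lt_trans (g'lt _ Pp); apply: subset_card_le => r [].
exists [set r | [/\ g' p r, r ∈ M & le p r]].
  split=> [r [_ Mr pr]|a [[Pa Ma] /= pa]].
    by split=> //; split=> //; have [] := leP _ _ pr.
  have Da := PD _ Pa.
  have [r Dr [pr [ra [[c Dc pcr] [b Db abr]]]]] := GF _ Dp _ Da pa.
  exists r => //; split=> //; last exact: (fM a b).
  by split=> //; exists c.
by apply: cle_lt_trans (g'lt _ Pp); apply: subset_card_le => r [].
Qed.

End Reflection.

(** * Transitive closures and hereditarily small sets *)

Lemma trclE (x : V) : trcl x = x `|` \bigcup_(y in x) trcl y.
Proof.
apply/seteqP; split=> [z|z [zx|[y yx zy]]]; last 2 first.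
- exact: t_step.
- by apply: (t_trans _ _ _ y) => //; exact: t_step.
rewrite /trcl /=; elim=> {x z} [y x yx|z y x zy _ _ IHx]; first by left.
case: IHx => [yx|[w wx yw]]; right; first by exists y.
by exists w => //; exact: (t_trans _ _ _ y).
Qed.

(** By ∈-induction: the elements of [x], together with chosen bounds for their transitive closures,
    form a set. *)
Lemma trcl_small (x : V) : exists t : V, trcl x `<=` t.
Proof.
elim/(well_founded_ind mem_wf): x => x IH.
have /choice [t tP] : forall y, exists t : V, y ∈ x -> trcl y `<=` t.
  by move=> y; case: (pselect (y ∈ x)) => [/IH[t]|n]; [exists t|exists y].
exists (vfamily (fun s : {i : idx x & option (idx (t (elt i)))} =>
  if projT2 s is Some j then elt j else elt (projT1 s))).
rewrite trclE => z [[i iz]|[y yx zy]]; apply/mem_vfamily.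
  by exists (existT _ i None).
have [j jz] := tP _ yx _ zy; have [i iy] := yx; subst y.
by exists (existT _ i (Some j)).
Qed.

Section Hset.
Variables (theta : V) (rtheta : is_regular theta).

Lemma Hset_trans x y : Hset theta x -> y ∈ x -> Hset theta y.
Proof.
move=> Hx yx; apply: cle_lt_trans Hx; apply: subset_card_le => z zy.
by apply: (t_trans _ _ _ y) => //; exact: t_step.
Qed.

Lemma Hset_set (x : V) : x `<=` Hset theta -> members x #< theta -> Hset theta x.
Proof.
move=> xH xt; rewrite /Hset /= trclE; apply: regular_setU => //.
exact: regular_bigcup.
Qed.

End Hset.

(** * Choice of [theta0] and assembly of the equivalences *)

Unset Implicit Arguments.

Theorem theorem3p3 (kappa lambda P : V) (le : V -> V -> Prop)
    (hkappa : is_regular kappa) (hlambda : is_regular lambda)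
    (hlt : kappa ∈ lambda) (hP : is_partial_order P le) :
  exists2 theta0 : V, is_cardinal theta0 &
  forall theta : V, is_regular theta -> theta0 `<=` theta ->
  [<->
   forall M : V, elementary le M (Hset theta) ->
     vinter M lambda ∈ vsucc lambda ->
     le_kappa kappa le (P `&` M) P;
   forall M : V, elementary le M (Hset theta) ->
     vinter (vcard M) lambda `<=` vinter M lambda ->
     vinter M lambda ∈ vsucc lambda ->
     le_kappa kappa le (P `&` M) P;
   forall M : V, elementary le M (Hset theta) ->
     vinter M lambda ∈ lambda ->
     le_kappa kappa le (P `&` M) P;
   forall M : V, elementary le M (Hset theta) ->
     vcard M `<=` vinter M lambda ->
     vinter M lambda ∈ lambda ->
     le_kappa kappa le (P `&` M) P;
   exists2 E : set (set V), is_club P lambda E &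
     forall A, E A -> le_kappa kappa le A P;
   has_FN lambda kappa P le].
Proof.
have [t tP] := trcl_small P.
(* [T] includes [lambda] and the transitive closure of [P]. Once [theta] exceeds the size of [T],
   all of [P] is in [Hset theta], and [lambda] is in [theta]. *)
pose T := vfamily (fun s : idx t + idx lambda =>
  match s with inl i => elt i | inr i => elt i end).
have tT : t `<=` T by move=> x [i <-]; apply/mem_vfamily; exists (inl i).
have lT : lambda `<=` T by move=> x [i <-]; apply/mem_vfamily; exists (inr i).
have [theta0 c0 T0] := hartogs T; exists theta0 => // theta rt t0.
have Tt : members T #< theta.
  by apply: clt_le_trans T0 _; exact: subset_card_le.
have Plt : members P #< theta.
  apply: cle_lt_trans Tt; apply: subset_card_le => p Pp; apply/tT/tP.
  exact: t_step.
have PD : P `<=` Hset theta.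
  move=> p Pp; apply: cle_lt_trans Tt; apply: subset_card_le => x xp.
  by apply/tT/tP/(t_trans _ _ _ p) => //; exact: t_step.
have [[ot _] _ _] := rt; have [[ol _] _ _] := hlambda.
have lth : lambda ∈ theta.
  apply: contrapT => /(ordinal_notin ot ol) /subset_card_le tl.
  by have [_] := Tt; apply; apply: (card_le_trans tl); exact: subset_card_le.
have lD : lambda `<=` Hset theta.
  have [tt _ _ _] := ot => x xl; apply: (D_ordinal rt (@Hset_set _ rt)).
  exact: (tt _ lth).
have succ (M : V) : vinter M lambda ∈ lambda -> vinter M lambda ∈ vsucc lambda.
  by move=> Ml; apply/mem_vsucc; left.
have to6 : (forall M : V, elementary le M (Hset theta) ->
     vcard M `<=` vinter M lambda -> vinter M lambda ∈ lambda ->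
     le_kappa kappa le (P `&` M) P) -> has_FN lambda kappa P le.
  exact: (small_models_FN hkappa hlambda hlt lD PD hP).
have to1 (H : has_FN lambda kappa P le) (M : V) : elementary le M (Hset theta) ->
    vinter M lambda ∈ vsucc lambda -> le_kappa kappa le (P `&` M) P.
  by apply: (has_FN_le_kappa rt (@Hset_trans _) (@Hset_set _ rt) hkappa hlambda hlt).
tfae.
- by move=> H M el _; exact: H.
(* From (2) to (3) by way of (4), (6) and (1): a model as in (3) may be too large for (2) to apply
   to it. *)
- move=> H M el Ml; apply: to1 => //; last exact: succ.
  apply: to6 => N elN cN Nl; apply: H => //; last exact: succ.
  by move=> x /mem_vinter[/cN].
- by move=> H M el _; exact: H.
- by move=> /to6; exact: has_FN_club.
- exact: club_has_FN.
- exact: to1.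
Qed.
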